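(* Let $\mathcal G$ be a compact group acting continuously and linearly on $\mathbb R^n$, $\chi:\mathcal G\to\mathbb R$ a (continuous) one-dimensional real character, and $\psi_\lambda$ ($\lambda\in\mathbb R^m$ near $0$) a smooth family of local diffeomorphisms of $\mathbb R^n$ near $0$ with $g\circ\psi_\lambda\circ g^{-1}=\psi_\lambda^{\chi(g)}$ for all $g\in\mathcal G$, $\psi_\lambda(0)=0$, and $A_0$ invertible, where $A_\lambda:=D_x\psi_\lambda(0)$. Let $A_0=S_0+N_0$ be the Jordan--Chevalley decomposition. Let $k\ge 1$ and assume that $$\psi_\lambda(x)=\psi_\lambda^{NF}(x)+R_{k+1}(x,\lambda),\qquad \psi_\lambda^{NF}(S_0x)=S_0\psi_\lambda^{NF}(x),\qquad R_{k+1}(x,\lambda)=O(|x|^{k+1})$$ as $x\to0$, uniformly in $\lambda$ (with $\psi^{NF}$ and $R_{k+1}$ smooth). Let $q\ge1$, $U:=\ker(S_0^q-\mathrm I)$, and let $x^*:U\times\mathbb R^m\to\mathbb R^n$ and $\psi_r:U\times\mathbb R^m\to U$, $(u,\lambda)\mapsto \psi_{r,\lambda}(u)$, be the maps obtained by the Lyapunov--Schmidt reduction described in the context. Then $$x^*(u,\lambda)=u+O(|u|^{k+1})\quad\text{and}\quad\psi_{r,\lambda}(u)=\psi_\lambda^{NF}(u)+O(|u|^{k+1})$$ as $u\to0$, uniformly for $\lambda$ in some neighborhood of the origin of $\mathbb R^m$. Moreover, $D_u\psi_{r,\lambda}(0)=D_x\psi_\lambda^{NF}(0)|_U=A_\lambda|_U$;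 so the eigenvalues of $D_u\psi_{r,\lambda}(0)$ coincide with the eigenvalues of $A_\lambda$ which are close to $q$-th roots of unity.
   Context: The Jordan--Chevalley decomposition $A_0=S_0+N_0$ is the unique one with $S_0$ semisimple (diagonalizable over $\mathbb C$), $N_0$ nilpotent and $S_0N_0=N_0S_0$. One has $\chi(g)\in\{1,-1\}$, so $\psi^{\chi(g)}$ is $\psi$ or its inverse. All maps are local (near the origin; $\lambda$ small). Lyapunov--Schmidt reduction. Let $Y_q$ be the space of $q$-periodic sequences $(x_i)_{i\in\mathbb Z}$ in $\mathbb R^n$ ($x_{i+q}=x_i$), $\sigma((x_i)_i)=(x_{i+1})_i$ the shift, and for a map $f$ on $\mathbb R^n$ let $\widehat f((x_i)_i)=(f(x_i))_i$ be its lift to $Y_q$. The map $\xi:U\to\ker(\widehat S_0-\sigma)$, $\xi(u)=(S_0^iu)_{i\in\mathbb Z}$, is an isomorphism and $Y_q=\xi(U)\oplus\operatorname{Im}(\widehat S_0-\sigma)$. Define $\Psi_\lambda(u,v)\in U$ and $\Sigma_\lambda(u,v)\in\operatorname{Im}(\widehat S_0-\sigma)$, for $u\in U$ and $v\in\operatorname{Im}(\widehat S_0-\sigma)$ near $0$, by $\widehat\psi_\lambda(\xi(u)+v)=\xi(\Psi_\lambda(u,v))+\Sigma_\lambda(u,v)$. By the implicit function theorem the equation $\sigma v=\Sigma_\lambda(u,v)$ has, near the origin, a unique solution $v=v^*_\lambda(u)$, smooth in $(u,\lambda)$. Then $\psi_{r,\lambda}(u):=\Psi_\lambda(u,v_\lambda^*(u))$,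 and $x^*(u,\lambda)$ is the component of index $0$ of the sequence $\xi(u)+v_\lambda^*(u)$. *)

(* Defs.v *)
From HB Require Import structures.
From mathcomp Require Import all_boot all_order all_algebra.
From mathcomp Require Import all_classical all_reals all_analysis.
From mathcomp Require Import complex.

Set Implicit Arguments.
Unset Strict Implicit.
Unset Printing Implicit Defensive.

Import Order.TTheory GRing.Theory Num.Theory.
Import numFieldNormedType.Exports.

Local Open Scope classical_set_scope.
Local Open Scope ring_scope.

(* Vectors of R^n are rows and matrices act on the right: the linear map A is
   x |-> x *m A, in agreement with the library's jacobian, kermx, restrictmx
   and eigenvalue.  A family of maps f_lam(x) is a curried function f lam x,
   and a local map is a total function whose values matter only near 0. *)

HB.mixin Record Group_isTopological (G : Type) of Topological G & Group G := {
  mulg_continuous : continuous (fun p : G * G => (p.1 * p.2)%g);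
  invg_continuous : continuous (fun g : G => g^-1%g)
}.

#[short(type="topologicalGroupType")]
HB.structure Definition TopologicalGroup :=
  {G of Topological G & Group G & Group_isTopological G}.

Definition continuous_linear_action (R : realType) (n : nat)
    (G : topologicalGroupType) (act : G -> 'rV[R]_n -> 'rV[R]_n) : Prop :=
  [/\ continuous (fun p : G * 'rV[R]_n => act p.1 p.2),
      forall g, linear (act g),
      forall x, act 1%g x = x &
      forall g h x, act (g * h)%g x = act g (act h x)].

Definition continuous_character (R : realType) (G : topologicalGroupType)
    (chi : G -> R) : Prop :=
  [/\ continuous chi, chi 1%g = 1 & forall g h, chi (g * h)%g = chi g * chi h].

(* For finite-dimensional V, f is C^(k+1) on the open set D iff it is
   differentiable on D and all x |-> Df(x)v are C^k on D. *)
Fixpoint Ck (R : realType) (V W : normedModType R) (k : nat) (D : set V)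
    (f : V -> W) : Prop :=
  match k with
  | 0%N => forall x, D x -> {for x, continuous f}
  | k'.+1 => (forall x, D x -> differentiable f x) /\
             (forall v, Ck k' D (fun x => 'd f x v))
  end.

Definition smooth_near (R : realType) (V W : normedModType R) (a : V)
    (f : V -> W) : Prop :=
  exists2 D : set V, open_nbhs a D & forall k, Ck k D f.

Definition smooth_family (R : realType) (n m p : nat)
    (f : 'rV[R]_m -> 'rV[R]_n -> 'rV[R]_p) : Prop :=
  smooth_near (0, 0) (fun z : 'rV[R]_n * 'rV[R]_m => f z.2 z.1).

(* phi_lam is the local inverse of psi_lam; "near (0, 0)" is in (x, lam). *)
Definition local_diffeo_family (R : realType) (n m : nat)
    (psi phi : 'rV[R]_m -> 'rV[R]_n -> 'rV[R]_n) : Prop :=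
  [/\ smooth_family psi, smooth_family phi,
      \forall z \near ((0, 0) : 'rV[R]_n * 'rV[R]_m),
        phi z.2 (psi z.2 z.1) = z.1 &
      \forall z \near ((0, 0) : 'rV[R]_n * 'rV[R]_m),
        psi z.2 (phi z.2 z.1) = z.1].

(* psi^c for c = 1 or c = -1, phi being the inverse of psi; the characters of a
   compact group take no other value. *)
Definition sign_power (R : realType) (T : Type) (psi phi : T) (c : R) : T :=
  if c == -1 then phi else psi.

(* g o psi_lam o g^-1 = psi_lam^(chi g) as an identity of germs, for each g. *)
Definition reversible_equivariant (R : realType) (n m : nat)
    (G : topologicalGroupType) (act : G -> 'rV[R]_n -> 'rV[R]_n) (chi : G -> R)
    (psi phi : 'rV[R]_m -> 'rV[R]_n -> 'rV[R]_n) : Prop :=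
  forall g, \forall z \near ((0, 0) : 'rV[R]_n * 'rV[R]_m),
    act g (psi z.2 (act g^-1%g z.1)) = sign_power psi phi (chi g) z.2 z.1.

(* f_lam(x) = O(|x|^k) as x -> 0 in E, uniformly for lam in some neighbourhood
   of 0. *)
Definition uniform_O (R : realType) (n m : nat) (E : set 'rV[R]_n) (k : nat)
    (f : 'rV[R]_m -> 'rV[R]_n -> 'rV[R]_n) : Prop :=
  let F := within (E `*` setT) (nbhs ((0, 0) : 'rV[R]_n * 'rV[R]_m)) in
  (fun z => f z.2 z.1) =O_F (fun z => (`|z.1| ^+ k : R^o)).

Definition complexify (R : realType) (n : nat) (A : 'M[R]_n) : 'M[R[i]]_n :=
  map_mx (real_complex R) A.

Definition Jordan_Chevalley (R : realType) (n : nat) (A S N : 'M[R]_n) : Prop :=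
  [/\ A = S + N, diagonalizable (complexify S), exists j, N ^+ j = 0
    & S *m N = N *m S].

(* U = ker(S^q - I), as a row space *)
Definition fixU (R : realType) (n : nat) (S : 'M[R]_n) (q : nat) : 'M[R]_n :=
  kermx (S ^+ q - 1%:M).

Definition inU (R : realType) (n : nat) (U : 'M[R]_n) : set 'rV[R]_n :=
  [set u | (u <= U)%MS].

(* A self-map f of the subspace U, read in the basis row_base U of U; its
   jacobian is the matrix of Df : U -> U, as restrictmx U A is that of A|_U. *)
Definition in_basis (R : realType) (n : nat) (U : 'M[R]_n)
    (f : 'rV[R]_n -> 'rV[R]_n) : 'rV[R]_(\rank U) -> 'rV[R]_(\rank U) :=
  fun w => f (w *m row_base U) *m pinvmx (row_base U).

Arguments in_basis {R n} U f w.

Section LyapunovSchmidt.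
Variables (R : realType) (n m : nat).
Implicit Types (S : 'M[R]_n) (q : nat) (x v : int -> 'rV[R]_n).

Definition periodic q : set (int -> 'rV[R]_n) :=
  [set x | forall i, x (i + q%:Z) = x i].

Definition shift x : int -> 'rV[R]_n := fun i => x (i + 1).

Definition lift (f : 'rV[R]_n -> 'rV[R]_n) x : int -> 'rV[R]_n :=
  fun i => f (x i).

(* S^i for i in Z, S being invertible; defined by hand because 'M_n has a ring
   structure with inverse, hence integer powers, only when n is a successor. *)
Definition mxpowz S (i : int) : 'M[R]_n :=
  match i with Posz j => S ^+ j | Negz j => invmx S ^+ j.+1 end.

Definition xi S (u : 'rV[R]_n) : int -> 'rV[R]_n := fun i => u *m mxpowz S i.

(* Im (\hat S - sigma) in Y_q *)
Definition im_lift_shift S q : set (int -> 'rV[R]_n) :=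
  [set (fun i => lift (fun y => y *m S) x i - shift x i) | x in periodic q].

Definition seq_lt x (e : R) : Prop := forall i, `|x i| < e.

Definition LS_components S q
    (psi : 'rV[R]_m -> 'rV[R]_n -> 'rV[R]_n)
    (Psi : 'rV[R]_m -> 'rV[R]_n -> (int -> 'rV[R]_n) -> 'rV[R]_n)
    (Sigma : 'rV[R]_m -> 'rV[R]_n -> (int -> 'rV[R]_n) -> (int -> 'rV[R]_n))
    : Prop :=
  exists2 e : R, 0 < e & forall lam u v,
    `|lam| < e -> inU (fixU S q) u -> `|u| < e ->
    im_lift_shift S q v -> seq_lt v e ->
    [/\ inU (fixU S q) (Psi lam u v), im_lift_shift S q (Sigma lam u v) &
        forall i, lift (psi lam) (fun j => xi S u j + v j) i
                  = xi S (Psi lam u v) i + Sigma lam u v i].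

(* v^*_lam(u) is the solution of sigma v = Sigma_lam(u, v), unique near 0;
   smoothness on U x R^m is expressed in the basis row_base of U. *)
Definition LS_solution S q
    (Sigma : 'rV[R]_m -> 'rV[R]_n -> (int -> 'rV[R]_n) -> (int -> 'rV[R]_n))
    (vstar : 'rV[R]_m -> 'rV[R]_n -> (int -> 'rV[R]_n)) : Prop :=
  (exists d e : R, [/\ 0 < d, 0 < e & forall lam u,
     `|lam| < d -> inU (fixU S q) u -> `|u| < d ->
     [/\ im_lift_shift S q (vstar lam u), seq_lt (vstar lam u) e,
         shift (vstar lam u) = Sigma lam u (vstar lam u) &
         forall v, im_lift_shift S q v -> seq_lt v e ->
           shift v = Sigma lam u v -> v = vstar lam u]]) /\
  (forall i, smooth_family (fun lam (w : 'rV[R]_(\rank (fixU S q))) =>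
     vstar lam (w *m row_base (fixU S q)) i)).

Definition LS_point S (vstar : 'rV[R]_m -> 'rV[R]_n -> (int -> 'rV[R]_n))
    (lam : 'rV[R]_m) (u : 'rV[R]_n) : 'rV[R]_n := xi S u 0 + vstar lam u 0.

Definition LS_map
    (Psi : 'rV[R]_m -> 'rV[R]_n -> (int -> 'rV[R]_n) -> 'rV[R]_n)
    (vstar : 'rV[R]_m -> 'rV[R]_n -> (int -> 'rV[R]_n))
    (lam : 'rV[R]_m) (u : 'rV[R]_n) : 'rV[R]_n := Psi lam u (vstar lam u).

End LyapunovSchmidt.

Definition near_unity_root (R : realType) (q : nat) (r : R) (z : R[i]) : Prop :=
  exists2 zeta : R[i], zeta ^+ q = 1 & `|z - zeta| < real_complex R r.

(* Main.v *)
(* Reduction estimate.  For u in U and v = v*(u), subtracting the orbit of u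
   under S_0, along which psi = psi^NF + O(|u|^(k+1)) commutes with S_0, from
   psi(S_0^i u + v_i) = S_0^i psi_r(u) + v_(i+1) leaves the linear problem
     v_(i+1) = A_0 v_i + S_0^i p + w_i,   p = psi^NF(u) - psi_r(u) in U,
   with |w_i| <= eps max|v| + C |u|^(k+1), because psi is strictly differentiable
   at 0.  On U x Im (S_0 - sigma) this problem determines (p, v) linearly from w:
   projecting on U along Im (S_0^q - 1) gives p, and v_0 is then found by inverting
   an invertible matrix plus a nilpotent one commuting with it.  The term
   eps max|v| is absorbed, so |v| + |p| = O(|u|^(k+1)), and both estimates follow;
   the one on p also gives D psi_r(0) = D psi^NF(0)|_U.

   Spectrum.  Writing D = S_0^q - 1 and P for the projection on U, A_lam commutes
   with S_0, so its characteristic polynomial splits along U + Im D.  On U,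
   A_0^q - 1 is nilpotent, hence z^q - 1 is small for each eigenvalue z of A_lam|_U
   and z is close to a q-th root of unity.  On Im D, A_0^q - 1 is invertible, so
   z^q - 1 is bounded away from 0. *)
Require Import Defs.
From HB Require Import structures.
From mathcomp Require Import all_boot all_order all_algebra.
From mathcomp Require Import all_classical all_reals all_analysis.
From mathcomp Require Import complex ring lra zify.

Set Implicit Arguments.
Unset Strict Implicit.
Unset Printing Implicit Defensive.

Import Order.TTheory GRing.Theory Num.Theory.
Import numFieldNormedType.Exports.

Local Open Scope classical_set_scope.
Local Open Scope ring_scope.

(** * Linear algebra *)

Lemma unitmx_injP (F : fieldType) n (A : 'M[F]_n) :
  (forall u : 'rV_n, u *m A = 0 -> u = 0) -> A \in unitmx.
Proof.
move=> injA; rewrite -row_free_unit -kermx_eq0; apply/eqP/row_matrixP => i.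
by rewrite row0; apply: injA; apply/sub_kermxP; rewrite row_sub.
Qed.

(** If u (B + N) = 0 then u B = - u N, and commutation turns this into u B^i = (-1)^i u N^i for all
    i. At i = j the right side vanishes, and B can be cancelled j times. *)
Lemma unitmxD_nilp (F : fieldType) n (B N : 'M[F]_n) j :
  B \in unitmx -> N ^+ j = 0 -> B *m N = N *m B -> B + N \in unitmx.
Proof.
move=> uB N0 cBN; apply: unitmx_injP => u /eqP.
rewrite mulmxDr addr_eq0 => /eqP uBN.
have cBNX i : N ^+ i *m B = B *m N ^+ i.
  by apply/esym; exact: (@commrX 'M[F]_n B N i cBN).
have uBX i : u *m B ^+ i = (-1) ^+ i *: (u *m N ^+ i).
  elim: i => [|i IH]; first by rewrite !expr0 scale1r.
  rewrite exprSr -[X in _ *m X]/(B ^+ i *m B) mulmxA IH -scalemxAl -mulmxA cBNX.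
  rewrite mulmxA uBN mulNmx exprSr mulrN1 scaleNr scalerN; congr (- (_ *: _)).
  by rewrite exprS -mulmxA.
move: (uBX j); rewrite N0 mulmx0 scaler0.
elim: j {N0 uBX} => [|j IH]; first by rewrite mulmx1.
rewrite exprSr -[X in _ *m X]/(B ^+ j *m B) mulmxA => /(congr1 (mulmx^~ (invmx B))).
by rewrite mulmxK // mul0mx.
Qed.

(** P is the projection on ker D along the row space of D; by rank the two fill the whole space. A
    matrix commuting with D preserves both summands, hence commutes with P. *)
Lemma kermx_projection (F : fieldType) n (D : 'M[F]_n) :
  (kermx D :&: D = 0)%MS ->
  exists P : 'M[F]_n,
    [/\ P *m D = 0, D *m P = 0,
        forall p (u : 'M[F]_(p, n)), u *m D = 0 -> u *m P = u &
        forall T, T *m D = D *m T -> T *m P = P *m T].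
Proof.
move=> dUD; exists (proj_mx (kermx D) D).
have dDU : (D :&: kermx D = 0)%MS by rewrite capmxC.
have full : ((1%:M : 'M[F]_n) <= kermx D + D)%MS.
  rewrite sub1mx /row_full (mxrank_disjoint_sum dUD) mxrank_ker.
  by rewrite subnK ?rank_leq_row.
set P := proj_mx _ _.
have PD : P *m D = 0.
  by apply/sub_kermxP; rewrite -[P]mul1mx proj_mx_sub.
have DP : D *m P = 0 by rewrite proj_mx_0.
have idP p (u : 'M[F]_(p, n)) : u *m D = 0 -> u *m P = u.
  by move=> uD; rewrite proj_mx_id //; apply/sub_kermxP.
have coP : (1%:M - P <= D)%MS by rewrite -[P]mul1mx proj_mx_compl_sub.
split=> // T cTD.
have PTP : P *m T *m P = P *m T.
  by apply: idP; rewrite -mulmxA cTD mulmxA PD mul0mx.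
have [E QE] := submxP coP.
have : (1%:M - P) *m T *m P = 0.
  by rewrite QE -!mulmxA (mulmxA D) -cTD -mulmxA DP !mulmx0.
by rewrite mulmxBl mul1mx mulmxBl PTP => /eqP; rewrite subr_eq0 => /eqP.
Qed.

(** The rows of E and E' span complementary invariant subspaces, so [col_mx E E'] conjugates A to a
    block diagonal matrix. Keeping the conjugation as an identity between products avoids inverting
    over polynomials: the nonzero determinant of M is cancelled at the end. *)
Lemma char_poly_split (F : fieldType) n r s (A : 'M[F]_n) (a : 'M[F]_r) (b : 'M[F]_s)
    (E : 'M[F]_(r, n)) (E' : 'M[F]_(s, n)) :
  (r + s)%N = n -> row_free (col_mx E E') -> E *m A = a *m E -> E' *m A = b *m E' ->
  char_poly A = char_poly a * char_poly b.
Proof.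
move=> e; case: n / e A E E' => A E E' free EA EA'.
have uM : col_mx E E' \in unitmx by rewrite -row_free_unit.
rewrite /char_poly; set M := map_mx polyC (col_mx E E').
have uM' : \det M != 0 by rewrite det_map_mx polyC_eq0 -unitfE.
have comm r' (T : 'M[F]_(r', r + s)) (t : 'M[F]_r') : T *m A = t *m T ->
    map_mx polyC T *m char_poly_mx A = char_poly_mx t *m map_mx polyC T.
  by move=> TA; rewrite mulmxBr mulmxBl -!map_mxM TA mul_mx_scalar mul_scalar_mx.
have : M *m char_poly_mx A = block_mx (char_poly_mx a) 0 0 (char_poly_mx b) *m M.
  by rewrite /M map_col_mx mul_col_mx (comm _ _ _ EA) (comm _ _ _ EA') mul_block_col !mul0mx addr0 add0r.
move=> /(congr1 determinant); rewrite !det_mulmx det_ublock [RHS]mulrC.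
exact: (mulfI uM').
Qed.

(** Both sides are compared after multiplication by the l^1 norm s of the eigenvector, each column
    of M contributing at most e s. *)
Lemma eigenvalue_entry_bound (F : numFieldType) n (M : 'M[F]_n) (x : 'rV_n) mu e :
  x != 0 -> x *m M = mu *: x -> (forall i j, `|M i j| <= e) -> `|mu| <= n%:R * e.
Proof.
move=> x0 xM Me; pose s := \sum_j `|x 0 j|.
have s0 : 0 < s.
  rewrite lt_def sumr_ge0 // andbT; apply: contra x0 => /eqP s0.
  apply/eqP/rowP => j; rewrite mxE; apply/eqP; rewrite -normr_eq0.
  by move/eqP: s0; rewrite psumr_eq0 // => /allP/(_ j); rewrite mem_index_enum; apply.
rewrite -(ler_pM2r s0) {1}/s mulr_sumr.
have -> : n%:R * e * s = \sum_(j < n) \sum_i `|x 0 i| * e.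
  rewrite sumr_const card_ord -mulr_suml -/s -[in RHS]mulr_natl; ring.
apply: ler_sum => j _; rewrite -normrM; have := congr1 (fun y : 'rV_n => y 0 j) xM.
rewrite !mxE => <-; apply: le_trans (ler_norm_sum _ _ _) _.
by apply: ler_sum => i _; rewrite normrM ler_wpM2l.
Qed.

Lemma diag_ker_cap (F : fieldType) n (d : 'rV[F]_n) (u : 'rV_n) :
  u *m diag_mx d *m diag_mx d = 0 -> u *m diag_mx d = 0.
Proof.
move=> /rowP h; apply/rowP => j; have := h j.
rewrite !mul_mx_diag !mxE => /eqP; rewrite !mulf_eq0 -orbA orbb => h'.
by apply/eqP; rewrite mulf_eq0.
Qed.

(** A basis diagonalizing S diagonalizes D, and a diagonal matrix has the same kernel as its
    square. *)
Lemma diagonalizable_ker_cap (F : fieldType) n (S : 'M[F]_n) q :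
  diagonalizable S -> let D := S ^+ q - 1%:M in (kermx D :&: D = 0)%MS.
Proof.
move=> [P uP /(diagonalizable_forLR uP)[d Sd]] D.
have {}Sd : S = invmx P *m diag_mx d *m P by rewrite {1}Sd; exact: conjVmx.
pose e := \row_i (d 0 i ^+ q - 1).
have SX i : S ^+ i = invmx P *m diag_mx (\row_j d 0 j ^+ i) *m P.
  elim: i => [|i IH].
    have -> : \row_j d 0 j ^+ 0 = const_mx 1 by apply/rowP => j; rewrite !mxE.
    by rewrite diag_const_mx mulmx1 mulVmx.
  rewrite exprSr -[LHS]/(S ^+ i *m S) IH {}Sd !mulmxA mulmxK //.
  rewrite -[X in X *m P]mulmxA mulmx_diag; congr (_ *m diag_mx _ *m _).
  by apply/rowP => j; rewrite !mxE exprSr.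
have De : D = invmx P *m diag_mx e *m P.
  rewrite /D SX -[1%:M](mulVmx uP) -[X in _ - X *m _]mulmx1 -mulmxBl -mulmxBr.
  congr (_ *m _ *m _); apply/matrixP => i j; rewrite !mxE.
  by case: eqP => _; rewrite ?subrr.
apply/eqP/rowV0P => u; rewrite sub_capmx => /andP[/sub_kermxP uD /submxP[y yD]].
rewrite yD; move: uD; rewrite yD De !mulmxA mulmxK // => h.
have/(congr1 (mulmx^~ (invmx P))) := h; rewrite mulmxK // mul0mx => /diag_ker_cap ->.
by rewrite mul0mx.
Qed.

Lemma nilp_mul (R : pzRingType) (N T : R) j : GRing.comm N T -> N ^+ j = 0 -> (N * T) ^+ j = 0.
Proof. by move=> c N0; rewrite exprMn_comm // N0 mul0r. Qed.

(** T is the cofactor in the factorization of (S + N)^q - S^q by N. The second clause makes N T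
    nilpotent whenever N is. *)
Lemma exprD_nilp (R : pzRingType) (S N : R) q : GRing.comm S N ->
  exists2 T, (S + N) ^+ q = S ^+ q + N * T &
    forall Y, GRing.comm Y S -> GRing.comm Y N -> GRing.comm Y T.
Proof.
move=> cSN; exists (\sum_(i < q) (S + N) ^+ (q.-1 - i) * S ^+ i).
  have c : GRing.comm (S + N) S.
    by apply/commr_sym/commrD => //; exact: commr_refl.
  by apply/eqP; rewrite [X in _ == X]addrC -subr_eq (subrXX_comm q c) addrAC subrr add0r.
move=> Y cS cN; apply: commr_sum => i _; apply: commrM; apply: commrX => //.
exact: commrD.
Qed.

Lemma sum_expr_nilp (R : pzRingType) (M : R) q :
  exists2 T, \sum_(i < q) (1 + M) ^+ i = q%:R + M * T &
    forall Y, GRing.comm Y M -> GRing.comm Y T.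
Proof.
elim: q => [|q [T e cT]].
  by exists 0; [rewrite big_ord0 mulr0 addr0 | move=> Y _; exact: commr0].
have [T' e' cT'] := exprD_nilp q (commr_sym (commr1 M)).
exists (T + T').
  by rewrite big_ord_recr /= e e' expr1n -natr1 mulrDr addrACA.
move=> Y cY; apply: commrD; [exact: cT | apply: cT' => //; exact: commr1].
Qed.

(** * Invertibility and nilpotency on ker D and on Im D *)

Section SpectralUnits.
Variables (F : numFieldType) (n q j : nat) (S N P : 'M[F]_n).
Let D := S ^+ q - 1.
Hypotheses (cSN : GRing.comm S N) (Nj : N ^+ j = 0).
Hypotheses (PD : P * D = 0) (DP : D * P = 0).
Hypothesis (idP : forall u : 'rV_n, u *m D = 0 -> u *m P = u).
Hypothesis (PP : P * P = P).
Hypotheses (cPS : GRing.comm P S) (cPN : GRing.comm P N).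

(** Applying P to u (D + c P) = 0 kills the first term and leaves u P = 0; then u D = 0, so u = u P
    = 0. *)
Lemma unitmx_kerD c : c != 0 -> D + c *: P \in unitmx.
Proof.
move=> c0; apply: unitmx_injP => u; rewrite mulmxDr -scalemxAr => u0.
have : u *m P = 0.
  have := congr1 (mulmx^~ P) u0; rewrite /= mul0mx mulmxDl -mulmxA -[D *m P]/(D * P) DP.
  rewrite mulmx0 add0r -scalemxAl -mulmxA -[P *m P]/(P * P) PP => /eqP.
  by rewrite scaler_eq0 (negPf c0) => /eqP.
by move=> uP; move: u0; rewrite uP scaler0 addr0 => /idP <-.
Qed.

Let commDN : GRing.comm D N.
Proof. by apply/commr_sym/commrB; [apply: commrX; apply: commr_sym | exact: commr1]. Qed.

(** Since (S + N)^q - 1 = D + N T and D P = 0, only N T P remains, a commuting multiple of N. *)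
Lemma nilp_on_ker : (((S + N) ^+ q - 1) * P) ^+ j = 0.
Proof.
have [T AT cT] := exprD_nilp q cSN.
rewrite AT addrAC mulrDl -/D DP add0r -mulrA nilp_mul //.
apply: commrM; first by apply: cT; [exact: commr_sym | exact: commr_refl].
exact: commr_sym.
Qed.

(** Up to a commuting multiple of N, the matrix is D + P. Adding P makes invertibility on Im D a
    statement about the whole space. *)
Lemma unit_off_ker : ((S + N) ^+ q - 1) * (1 - P) + P \in unitmx.
Proof.
have [T AT cT] := exprD_nilp q cSN.
have -> : ((S + N) ^+ q - 1) * (1 - P) + P = (D + 1 *: P) + N * (T * (1 - P)).
  by rewrite AT addrAC -/D mulrDl mulrBr DP mulr1 subr0 scale1r addrAC mulrA.
have cNT : GRing.comm N (T * (1 - P)).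
  apply: commrM; first by apply: cT; [exact: commr_sym | exact: commr_refl].
  by apply: commrB; [exact: commr1 | exact: commr_sym].
apply: (@unitmxD_nilp _ _ _ _ j); first by rewrite unitmx_kerD ?oner_eq0.
  exact: nilp_mul.
have cDP : GRing.comm D P by rewrite /GRing.comm PD DP.
have cDT : GRing.comm D T.
  apply: cT => //; apply/commr_sym/commrB; last exact: commr1.
  by apply: commrX; exact: commr_refl.
apply: commr_sym; rewrite scale1r; apply: commrD; apply: commr_sym; apply: commrM => //.
- by apply: commrM => //; apply: commrB => //; exact: commr1.
- by apply: commrM; [exact: cT | apply: commrB; [exact: commr1 | exact: commr_refl]].
Qed.

(* S + N solves v_(i+1) = (S + N) v_i with v_q = v_0 only if v_0 is in the kernel
   of the first summand; the second one comes from the condition v \in Im (S - sigma). *)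
Lemma unit_cycle : (0 < q)%N -> S \in unitmx ->
  1 - (S + N) ^+ q + (\sum_(i < q) ((S + N) * invmx S) ^+ i) * P \in unitmx.
Proof.
move=> q0 uS; set V := invmx S.
have SV : S * V = 1 by exact: mulmxV.
have VS : V * S = 1 by exact: mulVmx.
have cV Y : GRing.comm Y S -> GRing.comm Y V.
  move=> cY; rewrite /GRing.comm -[LHS]mul1r -VS -!mulrA (mulrA S) -cY.
  by rewrite -mulrA SV mulr1.
have [T AT cT] := exprD_nilp q cSN.
have cVN : GRing.comm V N by apply/commr_sym/cV/commr_sym.
have [T' e cT'] := sum_expr_nilp (N * V) q.
(* The terms of the geometric sum are (1 + N V)^i, so the sum is q + N V T'. The matrix is thus - (D
   - q P) plus a commuting multiple of N, and q is nonzero in characteristic 0. *)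
have -> : 1 - (S + N) ^+ q + (\sum_(i < q) ((S + N) * V) ^+ i) * P =
    - (D + (- q%:R) *: P) + N * (V * T' * P - T).
  rewrite (eq_bigr (fun i : 'I_q => (1 + N * V) ^+ i)); last by move=> i _; rewrite mulrDl SV.
  rewrite e AT /D scaleNr mulrDl mulrBr !mulrA mulr_natl scaler_nat.
  rewrite !opprD !opprK !addrA [1 - _]addrC -!addrA; congr (_ + (_ + _)).
  by rewrite addrC -addrA.
have cNV : GRing.comm N V by exact: commr_sym.
have cPV : GRing.comm P V by exact: cV.
have cNT : GRing.comm N (V * T' * P - T).
  apply: commrB; last by apply: cT; [exact: commr_sym | exact: commr_refl].
  do 2![apply: commrM => //].
  by apply: cT'; apply: commrM => //; exact: commr_refl.
have cDS : GRing.comm D S.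
  by apply/commr_sym/commrB; [apply: commrX; exact: commr_refl | exact: commr1].
have cDP : GRing.comm D P by rewrite /GRing.comm PD DP.
apply: (@unitmxD_nilp _ _ _ _ j).
- rewrite -scaleN1r unitmxZ ?unitrN1 // unitmx_kerD // oppr_eq0 pnatr_eq0.
  by rewrite -lt0n.
- exact: nilp_mul.
apply: commr_sym; apply: commrN; apply: commrD.
  apply: commr_sym; apply: commrM => //; apply: commrB; last exact: cT.
  do 2![apply: commrM => //]; first exact: cV.
  by apply: cT'; apply: commrM => //; exact: cV.
rewrite /GRing.comm -[LHS]/(_ *m _) -[RHS]/(_ *m _) -scalemxAl -scalemxAr; congr (_ *: _).
apply: commr_sym; apply: commrM => //; apply: commrB; last exact: cT.
do 2![apply: commrM => //].
by apply: cT'; apply: commrM.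
Qed.
End SpectralUnits.

(** * Uniform estimates *)

Lemma rV_norm_le (R : realType) n (x : 'rV[R]_n) c :
  0 <= c -> (forall j, `|x 0 j| <= c) -> `|x| <= c.
Proof.
move=> c0 h; rewrite /Num.norm /= mx_normrE; apply/bigmax_leP; split=> // -[i j] _ /=.
by rewrite (ord1 i).
Qed.

Lemma rV_entry_le (R : realType) n (x : 'rV[R]_n) j : `|x 0 j| <= `|x|.
Proof.
rewrite [leRHS]/Num.norm /= mx_normrE.
exact: (@le_bigmax _ _ _ 0 (fun ij => `|x ij.1 ij.2|) (0, j)).
Qed.

Lemma mulmx_bound (R : realType) n p (M : 'M[R]_(n, p)) :
  exists2 K : R, 0 < K & forall x : 'rV_n, `|x *m M| <= K * `|x|.
Proof.
pose K := \sum_i \sum_j `|M i j|.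
have K0 : 0 <= K by apply: sumr_ge0 => i _; apply: sumr_ge0.
(* The added 1 keeps the constant positive when M = 0. *)
exists (K + 1) => [|x]; first by rewrite ltr_wpDl.
apply: rV_norm_le => [|j]; first by rewrite mulr_ge0 ?addr_ge0.
rewrite mxE; apply: le_trans (ler_norm_sum _ _ _) _.
rewrite mulrDl mul1r ler_wpDr // /K mulr_suml; apply: ler_sum => i _.
rewrite normrM mulrC ler_pM // ?rV_entry_le //.
by rewrite (bigD1 j) //= ler_wpDr // sumr_ge0.
Qed.

Lemma near_pair0P (R : realType) n m (Q : 'rV[R]_n * 'rV[R]_m -> Prop) :
  (\forall z \near ((0, 0) : 'rV[R]_n * 'rV[R]_m), Q z) <->
  exists2 d : R, 0 < d & forall x lam, `|x| < d -> `|lam| < d -> Q (x, lam).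
Proof.
split=> [/nbhs_ballP[d /= d0 dQ]|[d d0 dQ]].
  by exists d => // x lam xd ld; apply: dQ; split; rewrite /= -ball_normE /= sub0r normrN.
apply/nbhs_ballP; exists d => // -[x lam] [].
by rewrite /= -!ball_normE /= !sub0r !normrN; exact: dQ.
Qed.

Lemma near0P (R : realType) m (Q : 'rV[R]_m -> Prop) :
  (\forall lam \near (0 : 'rV[R]_m), Q lam) <->
  exists2 d : R, 0 < d & forall lam, `|lam| < d -> Q lam.
Proof.
split=> [/nbhs_ballP[d /= d0 dQ]|[d d0 dQ]].
  by exists d => // x xd; apply: dQ; rewrite /= -ball_normE /= sub0r normrN.
by apply/nbhs_ballP; exists d => // x; rewrite -ball_normE /= sub0r normrN; exact: dQ.
Qed.

(** Replaces the filter by one constant and one radius, the form in which all estimates are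
    combined. *)
Lemma uniform_OP (R : realType) n m (E : set 'rV[R]_n) k (f : 'rV[R]_m -> 'rV[R]_n -> 'rV[R]_n) :
  uniform_O E k f <->
  exists C d : R, [/\ 0 < C, 0 < d & forall x lam, E x -> `|x| < d -> `|lam| < d ->
    `|f lam x| <= C * `|x| ^+ k].
Proof.
rewrite /uniform_O; split.
  move=> /eqO_exP[C C0]; rewrite near_withinE => /near_pair0P[d d0 h].
  exists C, d; split=> // x lam Ex xd ld.
  by have := h x lam xd ld (conj Ex I); rewrite /= normrX normr_id.
move=> [C [d [C0 d0 h]]]; apply/eqO_exP; exists C => //.
rewrite near_withinE; apply/near_pair0P; exists d => // x lam xd ld [Ex _] /=.
by rewrite normrX normr_id; exact: h.
Qed.

Lemma slice_diff (R : realType) n m p (F : 'rV[R]_n * 'rV[R]_m -> 'rV[R]_p) x lam :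
  differentiable F (x, lam) ->
  differentiable (fun y => F (y, lam)) x /\
  forall v, 'd (fun y => F (y, lam)) x v = 'd F (x, lam) (v, 0).
Proof.
move=> dF; pose g (y : 'rV[R]_n) := (y, lam).
have dg : is_diff x g (fun v => (v, 0)).
  exact: (@is_diff_pair R _ _ _ id id (cst lam) 0).
have dg' : differentiable g x by exact: ex_diff.
split=> [|v]; first exact: (differentiable_comp dg' dF).
by rewrite -[fun y => _]/(F \o g) (diff_comp dg' dF) /= diff_val.
Qed.

(** The norm is a maximum over entries, so the scalar mean value theorem on the segment from x to x
    + y can be applied to each entry separately. *)
Lemma diff_norm_le (R : realType) n p (f : 'rV[R]_n -> 'rV[R]_p) x y c : 0 <= c ->
  (forall t : R, 0 <= t <= 1 -> differentiable f (x + t *: y)) ->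
  (forall t : R, 0 <= t <= 1 -> `|'d f (x + t *: y) y| <= c) ->
  `|f (x + y) - f x| <= c.
Proof.
move=> c0 df dfc; apply: rV_norm_le => // j.
pose g (t : R) : R := f (x + t *: y) 0 j.
have dg (t : R) : 0 <= t <= 1 -> is_derive t (1 : R) g (('d f (x + t *: y) y) 0 j).
  move=> t01; pose l (s : R) := x + s *: y.
  have dl : is_diff t l (fun s => 0 + s *: y).
    exact: (is_diffD (is_diff_cst x t) (is_diff_scalel t y)).
  have dl' : differentiable l t by exact: ex_diff.
  have dfl : differentiable (f \o l) t.
    by apply: differentiable_comp => //; exact: df.
  have dfl1 : derivable (f \o l) t 1 by exact: diff_derivable.
  apply: DeriveDef; first exact: ((derivable_mxP _ _ _).1 dfl1 0 j).
  have := derive_mx dfl1; rewrite deriveE // diff_comp //=; last exact: df.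
  by rewrite diff_val add0r scale1r => ->; rewrite mxE.
have [t||t t01] := @MVT R g (fun t => ('d f (x + t *: y) y) 0 j) 0 1 ltr01.
- rewrite in_itv /= => /andP[t0 t1]; apply: dg; rewrite ltW //= ltW //.
- apply: derivable_within_continuous => t; rewrite in_itv => t01.
  by have [] := dg t t01.
rewrite /g subr0 mulr1 scale1r scale0r addr0 !mxE => ->.
apply: le_trans (rV_entry_le _ _) (dfc _ _).
by move: t01; rewrite in_itv /= => /andP[t0 t1]; rewrite !ltW.
Qed.

Lemma lin1_mx_dist (R : realType) n p (f g : 'rV[R]_n -> 'rV[R]_p) i j e :
  `|f (delta_mx 0 i) - g (delta_mx 0 i)| <= e -> `|lin1_mx f i j - lin1_mx g i j| <= e.
Proof. by apply: le_trans; apply: le_trans (rV_entry_le _ j); rewrite !mxE. Qed.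

Lemma mulmxr_continuous (R : realType) n p (M : 'M[R]_(n, p)) :
  continuous (mulmxr M : 'rV_n -> 'rV_p).
Proof.
have [K K0 hK] := mulmx_bound M; apply: bounded_linear_continuous.
apply/linear_boundedP; exists K; split; first exact: gtr0_real.
move=> r Kr x; apply: le_trans (hK x) _.
by rewrite ler_wpM2r // ltW.
Qed.

#[global] Instance is_diff_mulmxr (R : realType) n p (M : 'M[R]_(n, p)) (x : 'rV_n) :
  is_diff x (fun y : 'rV_n => y *m M) (fun y : 'rV_n => y *m M).
Proof.
have cM := @mulmxr_continuous R n p M.
apply: DiffDef; first exact: (@linear_differentiable _ _ _ (mulmxr M)).
by rewrite (@diff_lin _ _ _ (mulmxr M)).
Qed.

(** * First-order estimates for smooth families, uniform in the parameter *)

Section SmoothFamily.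
Variables (R : realType) (n m p : nat) (f : 'rV[R]_m -> 'rV[R]_n -> 'rV[R]_p).
Hypothesis sf : smooth_family f.
Let F (z : 'rV[R]_n * 'rV[R]_m) := f z.2 z.1.

Lemma smooth_family_C1 : exists2 d : R, 0 < d & forall (x : 'rV_n) (lam : 'rV_m), `|x| < d -> `|lam| < d ->
  differentiable (f lam) x /\ (forall v, 'd (f lam) x v = 'd F (x, lam) (v, 0)).
Proof.
have [D [oD D0] /(_ 1%N) [dF _]] := sf.
have /near_pair0P[d d0 dD] : nbhs ((0, 0) : 'rV[R]_n * 'rV[R]_m) D by exact: open_nbhs_nbhs.
by exists d => // x lam xd ld; apply: (@slice_diff _ _ _ _ F); apply: dF; exact: dD.
Qed.

Lemma smooth_family_diff_near v e : 0 < e ->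
  exists2 d : R, 0 < d & forall (x : 'rV_n) (lam : 'rV_m), `|x| < d -> `|lam| < d ->
    `|'d (f lam) x v - 'd (f 0) 0 v| <= e.
Proof.
move=> e0; have [D [oD D0] /(_ 1%N) [_ cF]] := sf.
have [d1 d10 h1] := smooth_family_C1.
have /cvgrPdist_le/(_ e e0)/near_pair0P[d2 d20 h2] := cF (v, 0) (0, 0) D0.
exists (Num.min d1 d2); first by rewrite lt_min d10.
move=> x lam; rewrite !lt_min => /andP[x1 x2] /andP[l1 l2].
have e1 := (h1 x lam x1 l1).2 v.
have e2 : 'd (f 0) 0 v = 'd F (0, 0) (v, 0) by apply: (h1 0 0 _ _).2; rewrite normr0.
have -> : 'd (f lam) x v - 'd (f 0) 0 v = 'd F (x, lam) (v, 0) - 'd F (0, 0) (v, 0).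
  exact (f_equal2 (fun a b : 'rV[R]_p => a - b) e1 e2).
by rewrite distrC; exact: (h2 x lam).
Qed.

Lemma smooth_family_cont e : 0 < e ->
  exists2 d : R, 0 < d & forall (x : 'rV_n) (lam : 'rV_m), `|x| < d -> `|lam| < d ->
    `|f lam x - f 0 0| <= e.
Proof.
move=> e0; have [D [oD D0] /(_ 0%N) cF] := sf.
have /cvgrPdist_le/(_ e e0)/near_pair0P[d2 d20 h2] := cF (0, 0) D0.
by exists d2 => // x lam x2 l2; rewrite distrC; exact: h2.
Qed.

Lemma smooth_family_jacobian_near e : 0 < e ->
  exists2 d : R, 0 < d & forall (x : 'rV_n) (lam : 'rV_m), `|x| < d -> `|lam| < d ->
    forall i j, `|'J (f lam) x i j - 'J (f 0) 0 i j| <= e.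
Proof.
move=> e0.
suff [d d0 h] : exists2 d : R, 0 < d & forall i : 'I_n, forall (x : 'rV_n) (lam : 'rV_m), `|x| < d -> `|lam| < d ->
    `|'d (f lam) x (delta_mx 0 i) - 'd (f 0) 0 (delta_mx 0 i)| <= e.
  exists d => // x lam xd ld i j; rewrite /jacobian; apply: lin1_mx_dist. exact: (h i x lam xd ld).
have h i := smooth_family_diff_near (delta_mx 0 i : 'rV_n) e0.
pose d i := s2val (cid2 (h i)).
have d0 i : 0 < d i by rewrite /d; case: cid2.
(* One radius per basis vector; the minimum starts from 1, so it is positive for n = 0 as well. *)
exists (\big[Num.min/1]_i d i); first by apply/lt_bigmin.
move=> i x lam xd ld; have := s2valP' (cid2 (h i)); apply.
  by apply: lt_le_trans xd _; exact: bigmin_le_cond.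
by apply: lt_le_trans ld _; exact: bigmin_le_cond.
Qed.

(** The mean value inequality is applied to f_lam minus its linear part A at the origin, whose
    derivative is uniformly small near (0, 0). *)
Lemma smooth_family_strict_diff e : 0 < e ->
  exists2 d : R, 0 < d & forall (x y : 'rV_n) (lam : 'rV_m), `|x| < d -> `|y| < d -> `|lam| < d ->
    `|f lam (x + y) - f lam x - y *m 'J (f 0) 0| <= e * `|y|.
Proof.
move=> e0; have n0 : 0 < n.+1%:R :> R by rewrite ltr0n.
(* Entries are made smaller than e / (n + 1) because a row times the matrix sums n of them; n + 1
   avoids division by 0. *)
have [d1 d10 h1] := smooth_family_jacobian_near (divr_gt0 e0 n0).
have [d2 d20 h2] := smooth_family_C1.
(* Halving keeps the segment x + t y inside the ball where both bounds hold. *)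
pose d := Num.min d1 d2 / 2; have d0 : 0 < d by rewrite divr_gt0 // lt_min d10.
exists d => // x y lam xd yd ld; pose A := 'J (f 0) 0.
pose g x := f lam x - x *m A.
have -> : f lam (x + y) - f lam x - y *m 'J (f 0) 0 = g (x + y) - g x.
  by rewrite /g mulmxDl !opprD !opprK !addrA; apply/rowP => j; rewrite !mxE; ring.
have near t : 0 <= t <= 1 -> `|x + t *: y| < Num.min d1 d2.
  move=> /andP[t0 t1]; apply: le_lt_trans (ler_normD _ _) _.
  rewrite (splitr (Num.min d1 d2)) ltrD // normrZ ger0_norm //.
  by apply: le_lt_trans yd; rewrite ler_piMl.
have dd : d < Num.min d1 d2 by rewrite ltr_pdivrMr // ltr_pMr ?ltr1n // lt_min d10.
have lt2 r : r < Num.min d1 d2 -> r < d1 /\ r < d2 by rewrite lt_min => /andP.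
have dg t : 0 <= t <= 1 -> is_diff (x + t *: y) g (fun v => 'd (f lam) (x + t *: y) v - v *m A).
  move=> t01; have [df _] := h2 _ _ (lt2 _ (near t t01)).2 (lt2 _ (lt_trans ld dd)).2.
  have df' : is_diff (x + t *: y) (f lam) ('d (f lam) (x + t *: y)) by exact: differentiableP.
  exact: (is_diffB df' (is_diff_mulmxr _ _)).
apply: diff_norm_le => [|t t01|t t01].
- by rewrite mulr_ge0 // ltW.
- by have [] := dg t t01.
have [_ ->] := dg t t01.
have [l1 l2] : `|lam| < d1 /\ `|lam| < d2 by apply: lt2; exact: lt_trans ld dd.
have [x1 x2] : `|x + t *: y| < d1 /\ `|x + t *: y| < d2 by apply: lt2; exact: near.
have [df _] := h2 _ _ x2 l2.
have -> : 'd (f lam) (x + t *: y) y = y *m 'J (f lam) (x + t *: y) by rewrite mul_rV_lin1.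
rewrite -mulmxBr; apply: rV_norm_le => [|j]; first by rewrite mulr_ge0 // ltW.
rewrite mxE; apply: le_trans (ler_norm_sum _ _ _) _.
apply: (@le_trans _ _ (\sum_(i < n) `|y| * (e / n.+1%:R))).
  apply: ler_sum => i _; rewrite normrM ler_pM // ?rV_entry_le //.
  by rewrite [X in `|X|]mxE [X in _ + X]mxE h1.
rewrite sumr_const card_ord [leRHS]mulrC -[leLHS]mulr_natr -mulrA ler_wpM2l //.
by rewrite mulrAC ler_pdivrMr // ler_wpM2l ?ler_nat // ltW.
Qed.
End SmoothFamily.

(** * The linearized reduced equation *)

Lemma mulmx_bound_family (R : realType) n p (M : nat -> 'M[R]_(n, p)) k :
  exists2 K : R, 0 < K & forall i (x : 'rV_n), (i < k)%N -> `|x *m M i| <= K * `|x|.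
Proof.
elim: k => [|k [K K0 hK]]; first by exists 1.
have [L L0 hL] := mulmx_bound (M k); exists (K + L); first exact: addr_gt0.
move=> i x; rewrite ltnS leq_eqVlt mulrDl => /orP[/eqP ->|/hK h].
  by rewrite ler_wpDl // mulr_ge0 // ltW.
by rewrite ler_wpDr // mulr_ge0 // ltW.
Qed.

Lemma sum_mulmx_bound (R : realType) n p (M : nat -> 'M[R]_(n, p)) k :
  exists2 K : R, 0 < K & forall (w : nat -> 'rV_n) b, 0 <= b ->
    (forall i, (i < k)%N -> `|w i| <= b) -> `|\sum_(i < k) w i *m M i| <= K * b.
Proof.
have [K K0 hK] := mulmx_bound_family M k; exists (k%:R * K + 1) => [|w b b0 wb].
  by rewrite ltr_wpDl // mulr_ge0 // ltW.
apply: le_trans (ler_norm_sum _ _ _) _; rewrite mulrDl mul1r ler_wpDr //.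
apply: (@le_trans _ _ (\sum_(i < k) K * b)); last first.
  by rewrite sumr_const card_ord -mulrA mulr_natl.
apply: ler_sum => i _; apply: le_trans (hK _ _ (ltn_ord i)) _.
by rewrite ler_wpM2l ?wb // ltW.
Qed.

(** Discrete variation of constants: the deviation from the free orbit v_0 A^i only accumulates the
    forcing w, with a constant depending on A and k alone. *)
Lemma affine_iter_bound (R : realType) n (A : 'M[R]_n) k :
  exists2 C : R, 0 < C & forall (v w : nat -> 'rV_n) b, 0 <= b ->
    (forall i, (i < k)%N -> v i.+1 = v i *m A + w i) ->
    (forall i, (i < k)%N -> `|w i| <= b) ->
    forall i, (i <= k)%N -> `|v i - v 0%N *m A ^+ i| <= C * b.
Proof.
elim: k => [|k [C C0 hC]].
  by exists 1 => // v w b b0 _ _ i; rewrite leqn0 => /eqP ->; rewrite mulmx1 subrr normr0 mul1r.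
have [K K0 hK] := mulmx_bound A; exists (C + (K * C + 1)).
  by rewrite !addr_gt0 // mulr_gt0.
move=> v w b b0 vS wb i.
have h : forall i, (i <= k)%N -> `|v i - v 0%N *m A ^+ i| <= C * b.
  by apply: hC => // j jk; [apply: vS|apply: wb]; exact: ltnW.
rewrite leq_eqVlt mulrDl => /orP[/eqP -> |ik].
  rewrite vS // exprSr [X in _ - X]mulmxA addrAC -mulmxBl.
  rewrite ler_wpDl ?(mulr_ge0, ltW C0) // mulrDl mul1r.
  apply: le_trans (ler_normD _ _) _; rewrite lerD ?wb //.
  by apply: le_trans (hK _) _; rewrite -mulrA ler_wpM2l ?h // ltW.
by rewrite ler_wpDr ?h // mulr_ge0 // ltW // addr_gt0 // mulr_gt0.
Qed.

Section LinearEstimate.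
Variables (R : realType) (n q j : nat) (S N P : 'M[R]_n).
Let D := S ^+ q - 1.
Let V := invmx S.
Hypotheses (q0 : (0 < q)%N) (uS : S \in unitmx).
Hypotheses (cSN : GRing.comm S N) (Nj : N ^+ j = 0).
Hypotheses (PD : P * D = 0) (DP : D * P = 0).
Hypothesis (idP : forall u : 'rV_n, u *m D = 0 -> u *m P = u).
Hypothesis (PP : P * P = P).
Hypotheses (cPS : GRing.comm P S) (cPN : GRing.comm P N).
Implicit Types (v : int -> 'rV[R]_n) (p : 'rV[R]_n).

Let SV : S * V = 1. Proof. exact: mulmxV. Qed.
Let VS : V * S = 1. Proof. exact: mulVmx. Qed.
Let comm_V Y : GRing.comm Y S -> GRing.comm Y V.
Proof.
move=> cY; rewrite /GRing.comm -[LHS]mul1r -VS -!mulrA (mulrA S) -cY.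
by rewrite -mulrA SV mulr1.
Qed.

Let cSV : GRing.comm S V. Proof. by rewrite /GRing.comm SV VS. Qed.

Let SXVX i : S ^+ i * V ^+ i = 1.
Proof. by rewrite -exprMn_comm // SV expr1n. Qed.

Let VqP : V ^+ q * P = P.
Proof.
have : V ^+ q * (D * P) = 0 by rewrite DP mulr0.
rewrite mulrA mulrBr mulr1 -exprMn_comm; last exact: commr_sym.
by rewrite VS expr1n mulrBl mul1r => /eqP; rewrite subr_eq0 => /eqP.
Qed.

Lemma im_lift_shift_periodic v : im_lift_shift S q v -> v q%:Z = v 0.
Proof.
move=> [x xq <-]; rewrite /Defs.lift /Defs.shift /=.
have -> : x q%:Z = x 0 by rewrite -[q%:Z]add0r xq.
by have -> : x (q%:Z + 1) = x (0 + 1) by rewrite addrC xq.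
Qed.

(* With z_i = S^-i x_i the sum telescopes to P (z_0 - z_q), and S^q P = P. *)
Lemma im_lift_shift_proj v : im_lift_shift S q v ->
  \sum_(i < q) v (Posz i) *m (V ^+ i * P) = 0.
Proof.
move=> [x xq <-].
pose z i := x (Posz i) *m (V ^+ i * S * P).
rewrite (eq_bigr (fun i : 'I_q => - (z i.+1 - z i))); last first.
  move=> i _; rewrite /Defs.lift /Defs.shift mulmxBl opprB /z; congr (_ - _).
    rewrite -mulmxA; congr (_ *m _); rewrite -[LHS]/(S * _) mulrA; congr (_ * _).
    by apply: commrX.
  have -> : x (Posz i + 1) = x (Posz i.+1) by congr x; rewrite addrC.
  congr (_ *m _); rewrite exprSr -!mulrA; congr (_ * _).
  by rewrite mulrA VS mul1r.
rewrite sumrN -(big_mkord xpredT (fun i => z i.+1 - z i)) telescope_sumr //.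
apply/eqP; rewrite oppr_eq0 subr_eq0 /z -[Posz q]add0r xq; apply/eqP.
by rewrite -!mulrA -cPS (mulrA (V ^+ q)) VqP mul1r.
Qed.

Lemma xi_proj p : p *m D = 0 -> \sum_(i < q) xi S p (Posz i) *m (V ^+ i * P) = q%:R *: p.
Proof.
move=> /idP pP; rewrite (eq_bigr (fun _ => p)); last first.
  move=> i _; rewrite /xi /= -mulmxA -[(_ *m (V ^+ i * P))]/(S ^+ i * (V ^+ i * P)).
  by rewrite mulrA SXVX mul1r pP.
by rewrite sumr_const card_ord scaler_nat.
Qed.

(** The map v |-> \sum_i v_i V^i P vanishes on Im (S - sigma) and sends xi(p) to q p. *)
Lemma xi_im_direct p v : p *m D = 0 -> im_lift_shift S q v ->
  (forall i, xi S p i + v i = 0) -> p = 0.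
Proof.
move=> pD /im_lift_shift_proj vP h.
have : \sum_(i < q) (xi S p (Posz i) + v (Posz i)) *m (V ^+ i * P) = 0.
  by rewrite big1 // => i _; rewrite h mul0mx.
rewrite (eq_bigr _ (fun i _ => mulmxDl _ _ _)) big_split /= vP addr0 xi_proj // => /eqP.
by rewrite scaler_eq0 pnatr_eq0 -[q == 0%N]negbK -lt0n q0 => /eqP.
Qed.

(** The map v |-> \sum_i v_i V^i P applied to the recursion isolates p. With p known as forcing,
    periodicity and the vanishing of that map on v determine v_0 through the invertible matrix B,
    and v_0 determines the other v_i. *)
Lemma LS_linear_estimate : exists2 C : R, 0 < C &
  forall v p (w : nat -> 'rV[R]_n) b, 0 <= b -> im_lift_shift S q v -> p *m D = 0 ->
    (forall i, (i < q)%N ->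
       v (Posz i.+1) = v (Posz i) *m (S + N) + xi S p (Posz i) + w i) ->
    (forall i, (i < q)%N -> `|w i| <= b) ->
    `|p| <= C * b /\ forall i, (i < q)%N -> `|v (Posz i)| <= C * b.
Proof.
set A := S + N.
have cVN : GRing.comm V N by apply/commr_sym/comm_V/commr_sym.
have cAV : GRing.comm A V by apply: comm_V; apply/commr_sym/commrD => //; exact: commr_refl.
have cAP : GRing.comm P A by exact: commrD.
have cPV : GRing.comm P V by exact: comm_V.
have [K1 K10 hK1] := sum_mulmx_bound (fun i => V ^+ i.+1 * P) q.
have [K2 K20 hK2] := mulmx_bound S.
have [K3 K30 hK3] := mulmx_bound_family (fun i => S ^+ i) q.
have [K4 K40 hK4] := affine_iter_bound A q.
have [K5 K50 hK5] := sum_mulmx_bound (fun i => V ^+ i * P) q.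
have [K6 K60 hK6] := mulmx_bound_family (fun i => A ^+ i) q.
set B := 1 - A ^+ q + (\sum_(i < q) (A * V) ^+ i) * P.
have uB : B \in unitmx by exact: (unit_cycle cSN Nj PD DP).
have [K7 K70 hK7] := mulmx_bound (invmx B).
(* [Cp] bounds p, [Cw] the total forcing xi(p) + w, [C0] the initial value v_0, and [Cv] every
   v_i. *)
pose Cp := K2 * K1.
pose Cw := K3 * Cp + 1.
pose C0 := K7 * (K4 * Cw + K5 * (K4 * Cw)).
pose Cv := K4 * Cw + K6 * C0.
have Cp0 : 0 < Cp by rewrite mulr_gt0.
have Cw0 : 0 < Cw by rewrite addr_gt0 // mulr_gt0.
have C00 : 0 < C0 by rewrite mulr_gt0 // addr_gt0 // !mulr_gt0.
have Cv0 : 0 < Cv by rewrite addr_gt0 // mulr_gt0.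
exists (Cp + Cv); first exact: addr_gt0.
move=> v p w b b0 vV pD vS wb; have pP := idP pD.
have v0 := im_lift_shift_proj vV.
have vq := im_lift_shift_periodic vV.
have pw : q%:R *: p = - (\sum_(i < q) w i *m (V ^+ i.+1 * P)) *m S.
  (* The sum may be shifted by one index because v_q = v_0 and V^q P = P. *)
  have shiftP : \sum_(i < q) v (Posz i.+1) *m (V ^+ i.+1 * P) = 0.
    pose f i := v (Posz i) *m (V ^+ i * P).
    have fq : f q = f 0%N by rewrite /f vq VqP mul1r.
    have : \sum_(i < q.+1) f i = f 0%N by rewrite big_ord_recr /= v0 add0r fq.
    by rewrite big_ord_recl -[RHS]addr0 => /addrI.
  have /eqP := shiftP.
  (* In the shifted sum A V factors out of the first group, which vanishes, and the second group
     adds up to q p V. *)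
  rewrite (eq_bigr (fun i : 'I_q => v (Posz i) *m (V ^+ i * P) *m (A * V) +
     xi S p (Posz i) *m (V ^+ i * P) *m V + w i *m (V ^+ i.+1 * P))); last first.
    move=> i _; rewrite vS // !mulmxDl; congr (_ + _ + _).
      rewrite -!mulmxA; congr (_ *m _); rewrite -[LHS]/(A * (V ^+ i.+1 * P)).
      rewrite -[RHS]/(V ^+ i * (P * (A * V))) exprSr [P * _]mulrA cAP -!mulrA -cPV.
      by rewrite !mulrA; congr (_ * _ * _); apply: commrX.
    rewrite -!mulmxA; congr (_ *m (_ *m _)).
    by rewrite -[RHS]/(V ^+ i * (P * V)) cPV mulrA exprSr.
  rewrite !big_split /= -!mulmx_suml v0 mul0mx add0r xi_proj // addr_eq0 => /eqP.
  by move=> /(congr1 (mulmx^~ S)); rewrite /= -mulmxA -[V *m S]/(V * S) VS mulmx1.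
have pb : `|p| <= Cp * b.
  have q1 : 1 <= q%:R :> R by rewrite ler1n.
  apply: (@le_trans _ _ `|q%:R *: p|).
    by rewrite normrZ normr_nat ler_peMl.
  rewrite pw /Cp -mulrA; apply: le_trans (hK2 _) _.
  by rewrite normrN ler_wpM2l ?hK1 // ltW.
pose w' i := xi S p (Posz i) + w i.
have w'b i : (i < q)%N -> `|w' i| <= Cw * b.
  move=> iq; apply: le_trans (ler_normD _ _) _; rewrite /Cw mulrDl mul1r lerD ?wb //.
  by apply: le_trans (hK3 _ _ iq) _; rewrite -mulrA ler_wpM2l // ltW.
have Cwb : 0 <= Cw * b by rewrite mulr_ge0 // ltW.
pose e (i : nat) := v (Posz i) - v 0 *m A ^+ i.
have eb i : (i <= q)%N -> `|e i| <= K4 * (Cw * b).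
  apply: (hK4 (fun i => v (Posz i)) w' _ Cwb) => // k kq.
  by rewrite vS // addrA.
(* Two conditions are added: v_q = v_0 gives v_0 (1 - A^q) = e_q, and the vanishing sum gives v_0
   \sum_i (A V)^i P = - \sum_i e_i V^i P. *)
have v0B : v 0 *m B = e q - \sum_(i < q) e i *m (V ^+ i * P).
  rewrite /B mulmxDr mulmxBr /e -vq mulmx1 vq; congr (_ + _).
  rewrite (eq_bigr (fun i : 'I_q => v (Posz i) *m (V ^+ i * P) - v 0 *m ((A * V) ^+ i *m P))).
    by rewrite sumrB v0 sub0r opprK -mulmx_sumr -mulmx_suml.
  move=> i _; rewrite mulmxBl; congr (_ - _); rewrite -mulmxA; congr (_ *m _).
  by rewrite -[LHS]/(A ^+ i * (V ^+ i * P)) mulrA -exprMn_comm.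
have v0b : `|v 0| <= C0 * b.
  rewrite -[v 0](mulmxK uB) v0B /C0 -mulrA; apply: le_trans (hK7 _) _.
  rewrite ler_wpM2l ?(ltW K70) // mulrDl; apply: le_trans (ler_normB _ _) _.
  rewrite lerD // -!mulrA ?eb // hK5 // ?mulr_ge0 ?(ltW Cw0) ?(ltW K40) // => i iq.
  by rewrite eb // ltnW.
split=> [|i iq].
  by apply: le_trans pb _; rewrite mulrDl ler_wpDr // mulr_ge0 // ltW.
apply: (@le_trans _ _ (Cv * b)); last first.
  by rewrite ler_wpM2r // ler_wpDl // ltW.
have -> : v (Posz i) = e i + v 0 *m A ^+ i by rewrite /e subrK.
apply: le_trans (ler_normD _ _) _; rewrite /Cv mulrDl lerD //.
  by rewrite -mulrA eb // ltnW.
by apply: le_trans (hK6 _ _ iq) _; rewrite -mulrA ler_wpM2l // ltW.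
Qed.
End LinearEstimate.

(** * The projection attached to S_0, and periodic sequences *)

Lemma complexify_ker_cap (R : realType) n (S : 'M[R]_n) q :
  diagonalizable (complexify S) -> let D := S ^+ q - 1%:M in (kermx D :&: D = 0)%MS.
Proof.
(* Triviality of the intersection is a rank condition, so it may be checked over the complex
   numbers. *)
move=> /(diagonalizable_ker_cap q) /= h; apply/eqP; rewrite -(map_mx_eq0 (real_complex R)).
rewrite -mxrank_eq0 map_capmx map_kermx map_mxB map_mx1.
suff -> : map_mx (real_complex R) (S ^+ q) = complexify S ^+ q by rewrite h mxrank0.
rewrite /complexify; elim: q {h} => [|q IH]; first by rewrite !expr0 map_mx1.
by rewrite !exprS -IH; exact: map_mxM.
Qed.

(** S = A - N differs from an invertible matrix by a commuting nilpotent one. Whatever commutes with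
    S commutes with D, hence with P. *)
Lemma Jordan_Chevalley_projection (R : realType) n (A S N : 'M[R]_n) q :
  A \in unitmx -> Jordan_Chevalley A S N ->
  let D := S ^+ q - 1 in
  [/\ A = S + N, S \in unitmx, GRing.comm S N, exists j, N ^+ j = 0 &
   exists P : 'M[R]_n,
    [/\ P * D = 0 /\ D * P = 0, forall p (u : 'M[R]_(p, n)), u *m D = 0 -> u *m P = u,
        P * P = P &
        forall T, GRing.comm T S -> GRing.comm T P]].
Proof.
move=> uA [AE dS [j Nj] cSN] D; split=> //.
- have -> : S = A + - N by rewrite AE addrK.
  apply: (@unitmxD_nilp _ _ _ _ j) => //.
    by rewrite -mulN1r exprMn_comm ?Nj ?mulr0 //; apply: commr_sym; apply: commrN1.
  by rewrite AE mulmxN mulNmx mulmxDl mulmxDr cSN.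
- by exists j.
have [P [PD DP idP cP]] := kermx_projection (complexify_ker_cap q dS).
exists P; split=> //; first exact: idP.
move=> T cTS; apply: cP; apply: (@commrB _ T); last exact: commr1.
exact: commrX.
Qed.

Lemma fixUP (R : realType) n (S : 'M[R]_n) q (u : 'rV_n) :
  inU (fixU S q) u <-> u *m (S ^+ q - 1) = 0.
Proof. by split=> /sub_kermxP. Qed.

Lemma im_lift_shift_translate (R : realType) n (S : 'M[R]_n) q v :
  im_lift_shift S q v -> Defs.periodic q v.
Proof.
move=> [x xq <-] i; rewrite /Defs.lift /Defs.shift xq; congr (_ - _).
by rewrite addrAC xq.
Qed.

(** Reduces bounds over all integer indices to the window 0, ..., q - 1. *)
Lemma periodic_nat (R : realType) n q (v : int -> 'rV[R]_n) : (0 < q)%N -> Defs.periodic q v ->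
  forall i, exists2 l : nat, (l < q)%N & v i = v (Posz l).
Proof.
move=> q0 vq i; have q0' : (q : int) != 0 by rewrite -lt0n in q0 *.
have vk (k : nat) l : v (l + (k * q)%N%:Z) = v l.
  elim: k => [|k IH]; first by rewrite mul0n addr0.
  by rewrite mulSn PoszD addrCA addrC vq IH.
exists `|(i %% q)%Z|%N.
  by rewrite -ltz_nat gez0_abs ?modz_ge0 ?ltz_pmod.
rewrite gez0_abs ?modz_ge0 //.
(* [vk] translates by nonnegative multiples of q only, so the sign of the quotient decides which
   side is translated. *)
case: (ler0P (i %/ q)%Z) => iq.
  rewrite -(vk `|(i %/ q)%Z|%N i); congr v.
  by rewrite PoszM lez0_abs // {1}(divz_eq i q) mulNr addrAC subrr add0r.
rewrite -(vk `|(i %/ q)%Z|%N (i %% q)%Z); congr v.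
by rewrite PoszM gtz0_abs // addrC -divz_eq.
Qed.

(** * The Lyapunov-Schmidt solution *)

Lemma forall_ord_near (R : realType) k (Q : nat -> R -> Prop) :
  (forall i d d', Q i d -> d' <= d -> Q i d') ->
  (forall i, (i < k)%N -> exists2 d : R, 0 < d & Q i d) ->
  exists2 d : R, 0 < d & forall i, (i < k)%N -> Q i d.
Proof.
move=> mono; elim: k => [|k IH] h; first by exists 1.
have [d1 d10 h1] := IH (fun i ik => h i (ltnW ik)).
have [d2 d20 h2] := h k (ltnSn k).
exists (Num.min d1 d2); first by rewrite lt_min d10.
move=> i; rewrite ltnS leq_eqVlt => /orP[/eqP ->|ik].
  by apply: mono h2 _; rewrite ge_min lexx orbT.
by apply: mono (h1 i ik) _; rewrite ge_min lexx.
Qed.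

Section Reduction.
Variables (R : realType) (n m k q j : nat) (S N P : 'M[R]_n).
Variables (psi psiNF Rem : 'rV[R]_m -> 'rV[R]_n -> 'rV[R]_n).
Variables (Psi : 'rV[R]_m -> 'rV[R]_n -> (int -> 'rV[R]_n) -> 'rV[R]_n)
  (Sigma : 'rV[R]_m -> 'rV[R]_n -> (int -> 'rV[R]_n) -> (int -> 'rV[R]_n))
  (vstar : 'rV[R]_m -> 'rV[R]_n -> (int -> 'rV[R]_n)).
Let D := S ^+ q - 1.
Let U := fixU S q.
Hypotheses (q0 : (0 < q)%N) (uS : S \in unitmx).
Hypotheses (cSN : GRing.comm S N) (Nj : N ^+ j = 0).
Hypotheses (PD : P * D = 0) (DP : D * P = 0).
Hypothesis (idP : forall u : 'rV_n, u *m D = 0 -> u *m P = u).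
Hypothesis (PP : P * P = P).
Hypotheses (cPS : GRing.comm P S) (cPN : GRing.comm P N).
Hypotheses (spsi : smooth_family psi) (JA : 'J (psi 0) 0 = S + N).
Hypothesis psi0 : \forall lam \near (0 : 'rV[R]_m), psi lam 0 = 0.
Hypothesis psiE : \forall z \near ((0, 0) : 'rV[R]_n * 'rV[R]_m),
     psi z.2 z.1 = psiNF z.2 z.1 + Rem z.2 z.1.
Hypothesis NFS : \forall z \near ((0, 0) : 'rV[R]_n * 'rV[R]_m),
     psiNF z.2 (z.1 *m S) = psiNF z.2 z.1 *m S.
Hypothesis RemO : uniform_O setT k.+1 Rem.
Hypothesis comps : LS_components S q psi Psi Sigma.
Hypothesis sol : LS_solution S q Sigma vstar.

Lemma im_lift_shift0 : im_lift_shift S q (fun=> 0).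
Proof.
exists (fun=> 0); first by [].
by apply/funext => i; rewrite /Defs.lift /Defs.shift mul0mx subr0.
Qed.

(* The zero sequence solves the equation at u = 0, so it is v* by uniqueness. *)
Lemma vstar_at0 : exists2 d : R, 0 < d & forall lam, `|lam| < d -> vstar lam 0 = fun=> 0.
Proof.
have /near0P[d1 d10 p0] := psi0; have [e1 e10 hc] := comps.
have [[d [e [d0 e0 hs]]] _] := sol.
exists (Num.min (Num.min d1 e1) d); first by rewrite !lt_min d10 e10.
move=> lam; rewrite !lt_min => /andP[/andP[l1 l2] l3].
have U0 : inU U (0 : 'rV[R]_n) by rewrite /inU /= sub0mx.
have [_ _ _ uniq] := hs lam 0 l3 U0 ltac:(by rewrite normr0).
apply/esym/uniq; first exact: im_lift_shift0.
  by move=> i; rewrite normr0.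
have [Up Sim] := hc lam 0 (fun=> 0) l2 U0 ltac:(by rewrite normr0) im_lift_shift0
  ltac:(by move=> i; rewrite normr0).
set p := Psi _ _ _ in Up *; set s := Sigma _ _ _ in Sim *; move=> E.
have {}E i : xi S p i + s i = 0.
  by rewrite -E /Defs.lift /xi mul0mx addr0 p0.
(* The decomposition of the zero sequence is trivial because xi(U) meets Im (S - sigma) only in
   0. *)
have p00 : p = 0.
  by apply: (xi_im_direct q0 uS DP idP cPS _ Sim E); apply/fixUP.
by apply/funext => i; rewrite /Defs.shift; have := E i; rewrite p00 /xi mul0mx add0r.
Qed.

(** Each of the q components in one period is continuous in the coordinates of u and vanishes at the
    origin; periodicity gives the rest. *)
Lemma vstar_small e : 0 < e -> exists2 d : R, 0 < d & forall lam u,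
  `|lam| < d -> `|u| < d -> inU U u -> seq_lt (vstar lam u) e.
Proof.
move=> e0; have [d0 d00 v0] := vstar_at0.
have [[ds [es [ds0 es0 hs]]] sm] := sol.
have [K K0 hK] := mulmx_bound (pinvmx (row_base U)).
have e20 : 0 < e / 2 by rewrite divr_gt0.
have [d dgt0 hd] : exists2 d : R, 0 < d & forall i : nat, (i < q)%N -> forall lam u,
    `|lam| < d -> `|u| < d -> inU U u -> `|vstar lam u (Posz i)| <= e / 2.
  apply: (@forall_ord_near R q (fun i d => forall lam u,
    `|lam| < d -> `|u| < d -> inU U u -> `|vstar lam u (Posz i)| <= e / 2)).
    by move=> i d d' h dd lam u l1 u1; apply: h; exact: lt_le_trans dd.
  move=> i _; have [d dgt0 hd] := smooth_family_cont (sm (Posz i)) e20.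
  (* Dividing by K makes the coordinates of u in [row_base U] smaller than d. *)
  exists (Num.min d (d / K)); first by rewrite lt_min dgt0 divr_gt0.
  move=> lam u; rewrite !lt_min => /andP[l1 l2] /andP[u1 u2] uU.
  have uE : u *m pinvmx (row_base U) *m row_base U = u.
    by rewrite mulmxKpV // eq_row_base.
  have := hd (u *m pinvmx (row_base U)) lam _ l1; rewrite /= uE mul0mx v0 ?normr0 // subr0.
  apply; apply: le_lt_trans (hK _) _; by rewrite mulrC -ltr_pdivlMr.
exists (Num.min d ds); first by rewrite lt_min dgt0.
move=> lam u; rewrite !lt_min => /andP[l1 l2] /andP[u1 u2] uU i.
have [/im_lift_shift_translate vq _ _ _] := hs lam u l2 uU u2.
have [l lq ->] := periodic_nat q0 vq i.
apply: le_lt_trans (hd l lq lam u l1 u1 uU) _.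
by rewrite ltr_pdivrMr // ltr_pMr // ltr1n.
Qed.

(** The linear estimate is applied with a forcing w whose part depending on v has coefficient eps,
    small enough to be absorbed. *)
Lemma LS_reduction_estimate : exists C d : R, [/\ 0 < C, 0 < d &
  forall lam u, inU U u -> `|u| < d -> `|lam| < d ->
    `|vstar lam u 0| <= C * `|u| ^+ k.+1 /\
    `|psiNF lam u - Psi lam u (vstar lam u)| <= C * `|u| ^+ k.+1].
Proof.
have [C C0 hC] := LS_linear_estimate q0 uS cSN Nj PD DP idP PP cPS cPN.
have [K K0 hK] := mulmx_bound_family (fun i => S ^+ i) q.+1.
have qR : 0 < q%:R :> R by rewrite ltr0n.
(* Chosen so that q C eps = 1/2. *)
pose eps := (2 * (q%:R * C))^-1.
have eps0 : 0 < eps by rewrite invr_gt0 !mulr_gt0.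
have [d1 d10 strict] := smooth_family_strict_diff spsi eps0.
have /near_pair0P[d2 d20 psiE'] := psiE.
have /near_pair0P[d3 d30 NFS'] := NFS.
have /uniform_OP[CR [d4 [CR0 d40 RemO']]] := RemO.
have [e1 e10 hc] := comps.
have [[d5 [e5 [d50 e50 hs]]] _] := sol.
(* v must lie both where psi is decomposed by Psi and Sigma and where strict differentiability
   holds. *)
pose e2 := Num.min e1 d1.
have e20 : 0 < e2 by rewrite lt_min e10.
have [d6 d60 small] := vstar_small e20.
pose d7 := Num.min (Num.min d1 d2) (Num.min d3 d4).
have d70 : 0 < d7 by rewrite !lt_min d10 d20 d30.
have dK0 : 0 < d7 / K by rewrite divr_gt0.
pose c0 := CR * K ^+ k.+1.
have c00 : 0 < c0 by rewrite mulr_gt0 // exprn_gt0.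
exists (C * (2 * c0)); exists (Num.min (Num.min d7 (d7 / K)) (Num.min e1 (Num.min d5 d6))).
split; first by apply: mulr_gt0 => //; exact: mulr_gt0.
  by rewrite !lt_min d10 d20 d30 d40 dK0 e10 d50 d60.
move=> lam u uU; rewrite !lt_min => /andP[/andP[_ uK] /and3P[u1 u5 u6]].
move=> /andP[/andP[/andP[/andP[l1 l2] /andP[l3 l4]] _] /and3P[le1 l5 l6]].
have xs i : (i <= q)%N -> `|u *m S ^+ i| < d7.
  by move=> iq; apply: le_lt_trans (hK i u iq) _; rewrite mulrC -ltr_pdivlMr.
have lt7 x : x < d7 -> [/\ x < d1, x < d2, x < d3 & x < d4].
  by rewrite !lt_min => /andP[/andP[-> ->] /andP[-> ->]].
have [vV vs5 vsol _] := hs lam u l5 uU u5.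
have vsmall := small lam u l6 u6 uU.
set v := vstar lam u in vV vs5 vsol vsmall *.
have v1 : seq_lt v e1 by move=> i; have := vsmall i; rewrite lt_min => /andP[].
have vd1 i : `|v i| < d1 by have := vsmall i; rewrite lt_min => /andP[].
have [PsiU _ LSE] := hc lam u v le1 uU u1 vV v1.
set p := psiNF lam u - Psi lam u v.
have uD : u *m (S ^+ q - 1) = 0 by apply/fixUP.
have NFX i : (i <= q)%N -> psiNF lam (u *m S ^+ i) = psiNF lam u *m S ^+ i.
  elim: i => [|i IH] iq; first by rewrite !expr0 !mulmx1.
  have [_ _ x3 _] := lt7 _ (xs i (ltnW iq)).
  by rewrite exprSr !mulmxA NFS' //= IH // ltnW.
(* The normal form preserves U: psiNF(u) S^q = psiNF(u S^q) = psiNF(u). This is why the orbit is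
   controlled up to i = q included. *)
have pD : p *m (S ^+ q - 1) = 0.
  rewrite mulmxBl; have /fixUP -> := PsiU; rewrite subr0 mulmxBr mulmx1 -NFX //.
  by move: uD; rewrite mulmxBr mulmx1 => /eqP; rewrite subr_eq0 => /eqP ->; rewrite subrr.
(* The error of linearizing psi along v_i, plus the remainder of the normal form on the orbit of
   u. *)
pose w i := psi lam (u *m S ^+ i + v (Posz i)) - psi lam (u *m S ^+ i)
   - v (Posz i) *m (S + N) + Rem lam (u *m S ^+ i).
have vS i : (i < q)%N ->
    v (Posz i.+1) = v (Posz i) *m (S + N) + xi S p (Posz i) + w i.
  move=> iq; have [_ x2 _ _] := lt7 _ (xs i (ltnW iq)).
  have -> : v (Posz i.+1) = Defs.shift v (Posz i) by rewrite /Defs.shift addrC.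
  rewrite vsol; have := LSE (Posz i); rewrite /Defs.lift /xi /= /w => ->.
  rewrite psiE' //= NFX; last exact: ltnW.
  by rewrite mulmxBl; apply/rowP => l; rewrite !mxE; ring.
pose M := \sum_(i < q) `|v (Posz i)|.
have M0 : 0 <= M by apply: sumr_ge0.
have vM i : (i < q)%N -> `|v (Posz i)| <= M.
  by move=> iq; rewrite /M (bigD1 (Ordinal iq)) //= lerDl sumr_ge0.
pose c := c0 * `|u| ^+ k.+1.
have c_ge0 : 0 <= c by rewrite mulr_ge0 ?(ltW c00) // exprn_ge0.
have wb i : (i < q)%N -> `|w i| <= eps * M + c.
  move=> iq; have [x1 _ _ x4] := lt7 _ (xs i (ltnW iq)).
  apply: le_trans (ler_normD _ _) _; apply: lerD.
    rewrite -JA; apply: le_trans (strict _ _ _ x1 (vd1 _) l1) _.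
    by rewrite ler_wpM2l ?vM // ltW.
  apply: le_trans (RemO' _ _ I x4 l4) _.
  rewrite /c /c0 -mulrA ler_wpM2l ?(ltW CR0) // -exprMn.
  by apply: lerXn2r; rewrite ?nnegrE ?mulr_ge0 ?(ltW K0) // hK // ltnW.
have b0 : 0 <= eps * M + c by rewrite addr_ge0 // mulr_ge0 // ltW.
have [pb vb] := hC v p w _ b0 vV pD vS wb.
have : M <= q%:R * (C * (eps * M + c)).
  apply: (@le_trans _ _ (\sum_(i < q) (C * (eps * M + c)))).
    by apply: ler_sum => i _; exact: vb.
  by rewrite sumr_const card_ord mulr_natl.
have -> : q%:R * (C * (eps * M + c)) = M / 2 + q%:R * C * c.
  rewrite /eps; field; by rewrite !gt_eqF.
(* From M <= M / 2 + q C c follows M <= 2 q C c, that is eps M <= c. *)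
move=> hM; have {}hM : eps * M <= c.
  rewrite /eps ler_pdivrMl ?mulr_gt0 //.
  have := hM; lra.
have bc : C * (eps * M + c) <= C * (2 * c0) * `|u| ^+ k.+1.
  have -> : C * (2 * c0) * `|u| ^+ k.+1 = C * (2 * c) by rewrite /c !mulrA.
  rewrite ler_wpM2l ?(ltW C0) //; lra.
split; last exact: le_trans pb bc.
exact: le_trans (vb 0%N q0) bc.
Qed.

End Reduction.

(** * Jacobians at the origin *)

Lemma is_diff_remainder (R : realType) (V W : normedModType R) (f : V -> W)
    (df : {linear V -> W}) :
  continuous df ->
  (forall e, 0 < e -> \forall x \near (0 : V), `|f x - f 0 - df x| <= e * `|x|) ->
  is_diff 0 f df.
Proof.
move=> cdf h.
have fo : f \o shift 0 = cst (f 0) + df +o_ 0 id.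
  apply/eqaddoP => e e0; near=> x.
  rewrite -[X in `|X|]/(f (x + 0) - (f 0 + df x)) addr0 opprD addrA.
  by near: x; exact: h.
have dE := diff_unique cdf fo.
apply: DiffDef => //.
by apply/diff_locallyP; rewrite dE.
Unshelve. all: by end_near. Qed.

Lemma is_diff0_estimate (R : realType) n p (f : 'rV[R]_n -> 'rV[R]_p) (L : 'M[R]_(n, p)) :
  (forall e, 0 < e -> exists2 d : R, 0 < d & forall x, `|x| < d ->
     `|f x - f 0 - x *m L| <= e * `|x|) ->
  is_diff 0 f (fun x => x *m L).
Proof.
move=> h; apply: (@is_diff_remainder R _ _ f (mulmxr L)); first exact: mulmxr_continuous.
by move=> e e0; have [d d0 hd] := h e e0; apply/near0P; exists d.
Qed.

Lemma differentiable0_estimate (R : realType) n p (f : 'rV[R]_n -> 'rV[R]_p) :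
  differentiable f 0 -> forall e, 0 < e -> exists2 d : R, 0 < d & forall x, `|x| < d ->
     `|f x - f 0 - x *m 'J f 0| <= e * `|x|.
Proof.
move=> /diff_locally /eqaddoP h e /h /near0P[d d0 hd]; exists d => // x xd.
have := hd x xd; rewrite /= mul_rV_lin1.
by rewrite -[X in `|X|]/(f (x + 0) - (f 0 + 'd f 0 x)) addr0 opprD addrA.
Qed.

Lemma is_diff_jacobian (R : realType) n p (f : 'rV[R]_n -> 'rV[R]_p) x (L : 'M[R]_(n, p)) :
  is_diff x f (fun y => y *m L) -> 'J f x = L.
Proof.
move=> [_ dE]; apply/row_matrixP => i.
by rewrite !rowE /jacobian mul_rV_lin1 dE.
Qed.

(** A difference of order k + 1 >= 2 changes neither the value nor the derivative at 0. *)
Lemma jacobian_near_eq (R : realType) n p (f g : 'rV[R]_n -> 'rV[R]_p) C d k :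
  (0 < k)%N -> 0 < d -> differentiable f 0 ->
  (forall x, `|x| < d -> `|f x - g x| <= C * `|x| ^+ k.+1) ->
  is_diff 0 g (fun x => x *m 'J f 0).
Proof.
move=> k0 d0 df fg; have fg0 : f 0 = g 0.
  apply/eqP; rewrite -subr_eq0 -normr_eq0 eq_le normr_ge0 andbT.
  by have := fg 0; rewrite normr0 expr0n mulr0; apply.
have C1 : 0 < `|C| + 1 by rewrite ltr_wpDl.
apply: is_diff0_estimate => e e0.
have e20 : 0 < e / 2 by rewrite divr_gt0.
have [d1 d10 h1] := differentiable0_estimate df e20.
(* The radius 1 gives |x|^k <= |x|, and the last one then gives |C| |x|^k <= e / 2; [|C| + 1] is a
   positive denominator. *)
exists (Num.min (Num.min d d1) (Num.min 1 (e / 2 / (`|C| + 1)))).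
  by rewrite !lt_min d0 d10 ltr01 divr_gt0.
move=> x; rewrite !lt_min => /andP[/andP[xd x1] /andP[x2 x3]].
have -> : g x - g 0 - x *m 'J f 0 = (f x - f 0 - x *m 'J f 0) - (f x - g x).
  by rewrite fg0; apply/rowP => j; rewrite !mxE; ring.
rewrite [e]splitr mulrDl; apply: le_trans (ler_normB _ _) _.
apply: lerD; first exact: h1.
apply: le_trans (fg x xd) _; rewrite exprSr mulrA ler_wpM2r //.
apply: (@le_trans _ _ ((`|C| + 1) * `|x|)); last first.
  by rewrite mulrC -ler_pdivlMr // ltW.
apply: (@le_trans _ _ (`|C| * `|x| ^+ k)).
  by rewrite ler_wpM2r ?exprn_ge0 // ler_norm.
apply: ler_pM => //; first by rewrite lerDl.
by rewrite ler_iXnr // ltW.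
Qed.

(** The commutator h vanishes near 0, so its derivative there, computed by the chain rule, is 0. *)
Lemma jacobian_commute (R : realType) n (f : 'rV[R]_n -> 'rV[R]_n) (S : 'M[R]_n) d :
  0 < d -> differentiable f 0 -> (forall x, `|x| < d -> f (x *m S) = f x *m S) ->
  S *m 'J f 0 = 'J f 0 *m S.
Proof.
move=> d0 df fS; pose h x := f (x *m S) - f x *m S.
(* Stated at [0 *m S] so that the base point matches the one in the chain rule. *)
have df' : is_diff (0 *m S) f (fun x => x *m 'J f 0).
  rewrite mul0mx; apply: DiffDef => //; apply/funext => x.
  by rewrite /jacobian mul_rV_lin1.
have df0 : is_diff 0 f (fun x => x *m 'J f 0) by have := df'; rewrite mul0mx.
have h1 : is_diff 0 h (fun x => x *m (S *m 'J f 0 - 'J f 0 *m S)).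
  have d1 := @is_diff_comp _ _ _ _ _ _ f _ 0 (is_diff_mulmxr S 0) df'.
  have d2 := @is_diff_comp _ _ _ _ f _ (fun y => y *m S) _ 0 df0 (is_diff_mulmxr S (f 0)).
  apply: (is_diff_eq (is_diffB d1 d2)); apply/funext => x.
  by rewrite mulmxBr !mulmxA.
have h2 : is_diff 0 h (fun x => x *m 0).
  apply: is_diff0_estimate => e e0; exists d => // x xd.
  by rewrite /h !fS ?normr0 // !subrr mulmx0 !subr0 normr0 mulr_ge0 // ltW.
by apply/eqP; rewrite -subr_eq0 -(is_diff_jacobian h1) (is_diff_jacobian h2).
Qed.

(** Passing to coordinates is linear and bounded both ways, so closeness of order k + 1 on U
    survives with another constant. *)
Lemma in_basis_is_diff (R : realType) n (U : 'M[R]_n) (f g : 'rV[R]_n -> 'rV[R]_n) C d k :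
  (0 < k)%N -> 0 < d -> differentiable f 0 ->
  (forall u, inU U u -> `|u| < d -> `|f u - g u| <= C * `|u| ^+ k.+1) ->
  is_diff 0 (in_basis U g) (fun w => w *m restrictmx U ('J f 0)).
Proof.
move=> k0 d0 df fg.
have df' : is_diff (0 *m row_base U) f (fun x => x *m 'J f 0).
  rewrite mul0mx; apply: DiffDef => //; apply/funext => x.
  by rewrite /jacobian mul_rV_lin1.
have d1 := @is_diff_comp _ _ _ _ _ _ f _ 0 (is_diff_mulmxr (row_base U) 0) df'.
have d2 := @is_diff_comp _ _ _ _ _ _ (fun y => y *m pinvmx (row_base U)) _ 0 d1
   (is_diff_mulmxr _ _).
have dfU : is_diff 0 (in_basis U f) (fun w => w *m restrictmx U ('J f 0)).
  by apply: (is_diff_eq d2); apply/funext => w; rewrite /conjmx /= !mulmxA.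
have [K K0 hK] := mulmx_bound (row_base U).
have [L L0 hL] := mulmx_bound (pinvmx (row_base U)).
rewrite -(is_diff_jacobian dfU).
apply: (@jacobian_near_eq _ _ _ _ _ (L * (`|C| * K ^+ k.+1)) (d / K) k) => //.
  by rewrite divr_gt0.
move=> w wd; rewrite /in_basis -mulmxBl; apply: le_trans (hL _) _.
rewrite -mulrA ler_wpM2l ?(ltW L0) //.
have wU : inU U (w *m row_base U) by rewrite /inU /= mulmx_sub // eq_row_base.
apply: le_trans (fg _ wU _) _.
  by apply: le_lt_trans (hK _) _; rewrite mulrC -ltr_pdivlMr.
apply: (@le_trans _ _ (`|C| * `|w *m row_base U| ^+ k.+1)).
  by rewrite ler_wpM2r ?exprn_ge0 // ler_norm.
rewrite -mulrA ler_wpM2l // -exprMn lerXn2r ?nnegrE ?mulr_ge0 ?(ltW K0) //.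
Qed.

(** * Eigenvalues near roots of unity *)

Lemma norm_real_complex (R : realType) (x : R) :
  `|real_complex R x| = real_complex R `|x|.
Proof. by rewrite normc_def /= expr0n addr0 sqrtr_sqr. Qed.

Lemma eigenvalue_complexify_bound (R : realType) n (M : 'M[R[i]]_n) (x : 'rV_n) mu (e : R) :
  x != 0 -> x *m M = mu *: x -> (forall i j, `|M i j| <= real_complex R e) ->
  `|mu| <= real_complex R (n%:R * e).
Proof.
by move=> x0 xM Me; rewrite rmorphM rmorph_nat; exact: eigenvalue_entry_bound xM Me.
Qed.

(** z^q - 1 is the product of the q differences z - zeta; if all had modulus at least r, the product
    would have modulus at least r^q. *)
Lemma unity_root_close (R : realType) q (z : R[i]) (r : R) : (0 < q)%N -> 0 < r ->
  `|z ^+ q - 1| < real_complex R (r ^+ q) -> near_unity_root q r z.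
Proof.
move=> q0 r0 zq.
have p0 : 'X^q - 1 != 0 :> {poly R[i]} by rewrite -size_poly_gt0 size_XnsubC.
have [s sE] := closed_field_poly_normal ('X^q - 1 : {poly R[i]}).
have lc : lead_coef ('X^q - 1 : {poly R[i]}) = 1 by rewrite lead_coefXnsubC.
rewrite lc scale1r in sE.
have ss : size s = q.
  by have := congr1 (fun p : {poly R[i]} => size p) sE; rewrite /= size_XnsubC // size_prod_XsubC => -[].
have roots zeta : zeta \in s -> zeta ^+ q = 1.
  rewrite -root_prod_XsubC -sE rootE !hornerE subr_eq0 => /eqP //.
have zE : z ^+ q - 1 = \prod_(zeta <- s) (z - zeta).
  have := congr1 (horner^~ z) sE; rewrite /= !hornerE horner_prod => ->.
  by apply: eq_bigr => zeta _; rewrite !hornerE.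
have [/hasP[zeta zs zr]|/hasPn far] := boolP (has (fun zeta => `|z - zeta| < real_complex R r) s).
  by exists zeta => //; exact: roots.
exfalso; move: zq; rewrite zE normr_prod -ss rmorphXn.
have rC : 0 <= real_complex R r by rewrite ler0c ltW.
have far' zeta : zeta \in s -> real_complex R r <= `|z - zeta|.
  by move=> zs; rewrite real_leNgt ?far // realE ?rC // normr_ge0.
suff : real_complex R r ^+ size s <= \prod_(zeta <- s) `|z - zeta|.
  by move=> /le_lt_trans h /h; rewrite ltxx.
elim: s far' {sE ss roots zE far} => [|zeta s IH] far; first by rewrite big_nil.
rewrite big_cons exprS ler_pM ?exprn_ge0 ?far ?mem_head //.
by apply: IH => y ys; rewrite far // inE ys orbT.
Qed.

Lemma near_unity_root_expr (R : realType) q (c : R) : (0 < q)%N -> 0 < c ->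
  exists2 r0 : R, 0 < r0 & forall r (z : R[i]), r <= r0 -> near_unity_root q r z ->
    `|z ^+ q - 1| <= real_complex R c.
Proof.
(* L bounds the cofactor of z - zeta in z^q - zeta^q: q terms, with |z| <= 2 and |zeta| = 1. *)
move=> q0 c0; pose L : R := q%:R * 2 ^+ q.
have L0 : 0 < L by rewrite mulr_gt0 ?ltr0n // exprn_gt0.
exists (Num.min 1 (c / L)); first by rewrite lt_min ltr01 divr_gt0.
move=> r z; rewrite le_min => /andP[r1 rc] [zeta zq zr].
have nz : `|zeta| = 1.
  by apply/eqP; rewrite -(@pexpr_eq1 _ _ q) // -normrX zq normr1.
have zr' : `|z - zeta| <= real_complex R r by exact: ltW.
have z2 : `|z| <= 2.
  rewrite -[z](subrK zeta); apply: le_trans (ler_normD _ _) _.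
  rewrite nz -[leRHS]/(1 + 1) lerD2r; apply: le_trans zr' _.
  by rewrite -[1]/(real_complex R 1) lecR.
rewrite -zq subrXX normrM.
have sumb : `|\sum_(i < q) z ^+ (q.-1 - i) * zeta ^+ i| <= real_complex R L.
  apply: le_trans (ler_norm_sum _ _ _) _.
  apply: (@le_trans _ _ (\sum_(i < q) 2 ^+ q)); last first.
    by rewrite sumr_const card_ord /L rmorphM rmorph_nat rmorphXn rmorph_nat -[leLHS]mulr_natl.
  apply: ler_sum => i _; rewrite normrM !normrX nz expr1n mulr1.
  apply: (@le_trans _ _ (2 ^+ (q.-1 - i))).
    by rewrite lerXn2r ?nnegrE.
  rewrite ler_eXn2l ?ltr1n //; exact: leq_trans (leq_subr _ _) (leq_pred _).
apply: le_trans (ler_pM _ _ zr' sumb) _ => //.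
rewrite -rmorphM lecR -ler_pdivlMr //.
Qed.

(** * Matrix families continuous at the origin *)

Section MatrixFamily.
Variables (R : realType) (m : nat).

Definition entrywise_continuous n p (F : 'rV[R]_m -> 'M[R]_(n, p)) :=
  forall i j, {for 0, continuous (fun lam => F lam i j)}.

Lemma entrywise_continuous_cst n p (B : 'M[R]_(n, p)) : entrywise_continuous (fun=> B).
Proof. by move=> i j; exact: cst_continuous. Qed.

Lemma entrywise_continuousB n p (F G : 'rV[R]_m -> 'M[R]_(n, p)) :
  entrywise_continuous F -> entrywise_continuous G ->
  entrywise_continuous (fun lam => F lam - G lam).
Proof.
move=> cF cG i j; rewrite (_ : (fun lam => _) = (fun lam => F lam i j - G lam i j)).
  by apply: continuousB; [exact: cF | exact: cG].
by apply/funext => lam; rewrite !mxE.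
Qed.

Lemma entrywise_continuousD n p (F G : 'rV[R]_m -> 'M[R]_(n, p)) :
  entrywise_continuous F -> entrywise_continuous G ->
  entrywise_continuous (fun lam => F lam + G lam).
Proof.
move=> cF cG i j; rewrite (_ : (fun lam => _) = (fun lam => F lam i j + G lam i j)).
  by apply: continuousD; [exact: cF | exact: cG].
by apply/funext => lam; rewrite !mxE.
Qed.

Lemma entrywise_continuousM n p r (F : 'rV[R]_m -> 'M[R]_(n, p)) (G : 'rV[R]_m -> 'M[R]_(p, r)) :
  entrywise_continuous F -> entrywise_continuous G ->
  entrywise_continuous (fun lam => F lam *m G lam).
Proof.
move=> cF cG i j; rewrite (_ : (fun lam => _) = (fun lam => \sum_k F lam i k * G lam k j)).
  apply: (@cvg_big R^o _ +%R 0 xpredT (@add_continuous R^o) _ (nbhs (0 : 'rV[R]_m)) _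
    (fun k lam => F lam i k * G lam k j) (fun k => F 0 i k * G 0 k j) _) => k _.
  by apply: continuousM; [exact: cF | exact: cG].
by apply/funext => lam; rewrite !mxE.
Qed.

Lemma entrywise_continuousX n (F : 'rV[R]_m -> 'M[R]_n) q :
  entrywise_continuous F -> entrywise_continuous (fun lam => F lam ^+ q).
Proof.
move=> cF; elim: q => [|q IH]; first exact: entrywise_continuous_cst.
rewrite (_ : (fun lam => _) = (fun lam => F lam *m F lam ^+ q)).
  exact: entrywise_continuousM.
by apply/funext => lam; rewrite exprS.
Qed.

Lemma entrywise_continuous_near n p (F : 'rV[R]_m -> 'M[R]_(n, p)) e :
  entrywise_continuous F -> F 0 = 0 -> 0 < e ->
  \forall lam \near (0 : 'rV[R]_m), forall i j, `|F lam i j| <= e.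
Proof.
move=> cF F0 e0.
suff : \forall lam \near (0 : 'rV[R]_m), forall ij : 'I_n * 'I_p, `|F lam ij.1 ij.2| <= e.
  by apply: filterS => lam h i j; exact: h (i, j).
apply: (@filter_forall _ _ (fun ij lam => `|F lam ij.1 ij.2| <= e) (nbhs (0 : 'rV[R]_m)) _).
move=> [i j] /=.
have /cvgrPdist_le/(_ e e0) := cF i j.
by apply: filterS => lam; rewrite F0 mxE sub0r normrN.
Qed.
End MatrixFamily.

Lemma row_base_restrict (F : fieldType) n (V A : 'M[F]_n) :
  stablemx V A -> row_base V *m A = restrictmx V A *m row_base V.
Proof.
by move=> sV; rewrite /conjmx mulmxKpV // stablemx_row_base.
Qed.

(** Commuting with D makes both ker D and Im D stable, and these are complementary. *)
Lemma char_poly_restrict (F : fieldType) n (D A : 'M[F]_n) :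
  (kermx D :&: D = 0)%MS -> A *m D = D *m A ->
  char_poly A = char_poly (restrictmx (kermx D) A) * char_poly (restrictmx D A).
Proof.
move=> capD cAD.
have sU : stablemx (kermx D) A by apply/sub_kermxP; rewrite -mulmxA cAD mulmxA mulmx_ker mul0mx.
have sD : stablemx D A by rewrite -cAD submxMl.
apply: (char_poly_split _ _ (row_base_restrict sU) (row_base_restrict sD)).
  by rewrite mxrank_ker subnK // rank_leq_row.
rewrite /row_free -addsmxE (adds_eqmx (eq_row_base _) (eq_row_base _)).
by rewrite mxrank_disjoint_sum.
Qed.

(** * Eigenvalues of A_lam on ker D and on Im D *)

Section Spectrum.
Variables (R : realType) (m n q j : nat) (S N P : 'M[R]_n).
Variable A : 'rV[R]_m -> 'M[R]_n.
Let D := S ^+ q - 1.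
Hypotheses (q0 : (0 < q)%N) (cSN : GRing.comm S N) (Nj : N ^+ j = 0).
Hypotheses (PD : P * D = 0) (DP : D * P = 0).
Hypothesis (idP : forall p (u : 'M[R]_(p, n)), u *m D = 0 -> u *m P = u).
Hypothesis (PP : P * P = P).
Hypotheses (cPS : GRing.comm P S) (cPN : GRing.comm P N).
Hypotheses (A0 : A 0 = S + N) (cA : entrywise_continuous A).

Let toC n1 n2 (M : 'M[R]_(n1, n2)) := map_mx (real_complex R) M.

Lemma toC_expr (M : 'M[R]_n) k : toC (M ^+ k) = toC M ^+ k.
Proof.
elim: k => [|k IH]; first by rewrite !expr0 /toC map_mx1.
by rewrite !exprS -IH; exact: map_mxM.
Qed.

Lemma eigen_expr (F : fieldType) (M : 'M[F]_n) (x : 'rV_n) z k :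
  x *m M = z *: x -> x *m M ^+ k = z ^+ k *: x.
Proof.
move=> xM; elim: k => [|k IH]; first by rewrite !expr0 mulmx1 scale1r.
by rewrite exprS mulmxA xM -scalemxAl IH scalerA -exprS.
Qed.

(** The coordinates y record that the eigenvector lies in the complexification of V, where the
    action of P is known. *)
Lemma restrict_eigenvector (V B : 'M[R]_n) z : stablemx V B ->
  root (char_poly (complexify (restrictmx V B))) z ->
  exists2 x : 'rV[R[i]]_n, x != 0 /\ x *m toC B = z *: x &
    exists y, x = y *m toC (row_base V).
Proof.
move=> sV; rewrite -eigenvalue_root_char => /eigenvalueP[y yz y0].
exists (y *m toC (row_base V)); last by exists y.
split.
  apply: contra y0 => /eqP yE; apply/eqP.
  have : row_free (toC (row_base V)) by rewrite /row_free /toC mxrank_map; exact: row_base_free.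
  by move=> /row_free_inj inj; apply: inj; rewrite yE mul0mx.
by rewrite -mulmxA /toC -map_mxM row_base_restrict // map_mxM mulmxA yz scalemxAl.
Qed.

(** An eigenvector in U is fixed by P, so M lam multiplies it by (z^q - 1)^j; M is continuous and
    vanishes at 0 by nilpotency. *)
Lemma ker_spectrum r : 0 < r -> \forall lam \near (0 : 'rV[R]_m), forall z,
  stablemx (kermx D) (A lam) ->
  root (char_poly (complexify (restrictmx (kermx D) (A lam)))) z -> near_unity_root q r z.
Proof.
move=> r0; pose M lam := ((A lam ^+ q - 1) * P) ^+ j.
have cM : entrywise_continuous M.
  apply: entrywise_continuousX; apply: entrywise_continuousM; last exact: entrywise_continuous_cst.
  apply: entrywise_continuousB; [exact: entrywise_continuousX | exact: entrywise_continuous_cst].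
have M0 : M 0 = 0 by rewrite /M A0 (nilp_on_ker cSN Nj DP cPN).
(* Makes n e strictly smaller than (r^q)^j, for n = 0 too. *)
pose e := (r ^+ q) ^+ j / (2 * n.+1%:R).
have rq0 : 0 < (r ^+ q) ^+ j by rewrite !exprn_gt0.
have e0 : 0 < e by rewrite divr_gt0 // mulr_gt0 // ltr0n.
apply: filterS (entrywise_continuous_near cM M0 e0) => lam Me z sU.
move=> /(restrict_eigenvector sU)[x [x0 xA] [y xE]].
have xP : x *m toC P = x.
  rewrite xE -mulmxA /toC -map_mxM idP //.
  by apply/sub_kermxP; rewrite eq_row_base.
have xM : x *m toC (M lam) = (z ^+ q - 1) ^+ j *: x.
  rewrite toC_expr; apply: eigen_expr.
  rewrite /toC map_mxM map_mxB map_mx1 -/(toC (A lam ^+ q)) toC_expr mulmxA.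
  by rewrite mulmxBr (eigen_expr _ xA) mulmx1 -{2}[x]scale1r -scalerBl -scalemxAl xP.
have : `|(z ^+ q - 1) ^+ j| <= real_complex R (n%:R * e).
  apply: eigenvalue_complexify_bound x0 xM _ => a b.
  by rewrite mxE norm_real_complex lecR.
rewrite normrX => zj; apply: unity_root_close => //.
rewrite real_ltNge ?realE ?normr_ge0 ?ler0c ?exprn_ge0 ?(ltW r0) //.
apply/negP => far.
have : real_complex R ((r ^+ q) ^+ j) <= `|z ^+ q - 1| ^+ j.
  rewrite rmorphXn; apply: lerXn2r far; rewrite nnegrE; last exact: normr_ge0.
  by rewrite ler0c exprn_ge0 // ltW.
move=> /le_trans /(_ zj); rewrite lecR /e mulrCA ler_pMr // ler_pdivlMr ?mulr_gt0 ?ltr0n //.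
by rewrite mul1r -natrM ler_nat mulSn mul1n; lia.
Qed.

(* Q lam x = (z^q - 1) x for an eigenvector x; with B = Q 0^-1 the matrix
   1 - Q lam B + (z^q - 1) B fixes x, yet has small entries if z^q - 1 is small. *)
Lemma off_ker_spectrum : exists2 r0 : R, 0 < r0 & forall r, r <= r0 ->
  \forall lam \near (0 : 'rV[R]_m), forall z,
  stablemx D (A lam) -> near_unity_root q r z ->
  ~~ root (char_poly (complexify (restrictmx D (A lam)))) z.
Proof.
pose Q lam := (A lam ^+ q - 1) * (1 - P) + P.
have uQ0 : Q 0 \in unitmx by rewrite /Q A0; apply: (unit_off_ker cSN Nj PD DP _ PP cPS cPN); exact: idP.
pose B := invmx (Q 0); pose T lam := 1 - Q lam *m B.
have cT : entrywise_continuous T.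
  apply: entrywise_continuousB; first exact: entrywise_continuous_cst.
  apply: entrywise_continuousM; last exact: entrywise_continuous_cst.
  apply: entrywise_continuousD; last exact: entrywise_continuous_cst.
  apply: entrywise_continuousM; last exact: entrywise_continuous_cst.
  apply: entrywise_continuousB; [exact: entrywise_continuousX | exact: entrywise_continuous_cst].
have T0 : T 0 = 0 by rewrite /T /B mulmxV // subrr.
(* Two contributions of size e per entry then give n (e + e) < 1, contradicting the eigenvalue 1. *)
pose e : R := (4 * n.+1%:R)^-1.
have e0 : 0 < e by rewrite invr_gt0 mulr_gt0 // ltr0n.
pose K : R := 1 + \sum_a \sum_b `|B a b|.
have K0 : 0 < K by rewrite ltr_wpDr // sumr_ge0 // => a _; exact: sumr_ge0.
have BK a b : `|B a b| <= K.
  rewrite /K ler_wpDl // (bigD1 a) //= (bigD1 b) //= -addrA lerDl.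
  by rewrite addr_ge0 ?sumr_ge0 // => i _; exact: sumr_ge0.
(* For z this close to a root of unity, the entries of (z^q - 1) B are at most (e / K) K = e. *)
have [r0 r00 hr0] := @near_unity_root_expr R q (e / K) q0 (divr_gt0 e0 K0).
exists r0 => // r rr0.
apply: filterS (entrywise_continuous_near cT T0 e0) => lam Te z sD zr.
apply/negP => /(restrict_eigenvector sD)[x [x0 xA] [y xE]].
have xP : x *m toC P = 0.
  have /submxP[G GE] : (row_base D <= D)%MS by rewrite eq_row_base.
  by rewrite xE GE -mulmxA /toC -map_mxM -mulmxA -[D *m P]/(D * P) DP mulmx0 map_mx0 mulmx0.
have xQ : x *m toC (Q lam) = (z ^+ q - 1) *: x.
  rewrite /toC map_mxD mulmxDr xP addr0 map_mxM !map_mxB !map_mx1 -/(toC (A lam ^+ q)) toC_expr.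
  rewrite mulmxA [x *m (_ - _)]mulmxBr (eigen_expr _ xA) mulmx1 -{2}[x]scale1r -scalerBl.
  by rewrite -scalemxAl mulmxBr mulmx1 xP subr0.
pose X := toC (T lam) + (z ^+ q - 1) *: toC B.
have xX : x *m X = 1 *: x.
  rewrite mulmxDr /T /toC map_mxB map_mx1 map_mxM mulmxBr mulmx1 mulmxA xQ -scalemxAl.
  by rewrite -scalemxAr subrK scale1r.
have : `|1 : R[i]| <= real_complex R (n%:R * (e + e / K * K)).
  apply: eigenvalue_complexify_bound x0 xX _ => a b.
  have -> : X a b = real_complex R (T lam a b) + (z ^+ q - 1) * real_complex R (B a b).
    by rewrite /X mxE; congr (_ + _); rewrite mxE //; congr (_ * _); rewrite mxE.
  have -> : real_complex R (e + e / K * K) =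
      real_complex R e + real_complex R (e / K) * real_complex R K.
    by rewrite rmorphD; congr (_ + _); exact: rmorphM.
  apply: le_trans (ler_normD _ _) _.
  apply: lerD; first by rewrite norm_real_complex lecR.
  rewrite normrM; apply: ler_pM => //; first exact: hr0 rr0 zr.
  by rewrite norm_real_complex lecR.
rewrite normr1 -[1]/(real_complex R 1) lecR divfK ?gt_eqF // => h.
have : n%:R * (e + e) < 1.
  rewrite -mulr2n -[X in _ * X]mulr_natl mulrA /e ltr_pdivrMr ?mulr_gt0 ?ltr0n // mul1r -!natrM ltr_nat.
  lia.
by rewrite ltNge h.
Qed.
End Spectrum.

(** * Order of the reduction, its linearization and its spectrum *)

Theorem proposition3p1 (R : realType) (n m k q : nat)
  (G : topologicalGroupType) (act : G -> 'rV[R]_n -> 'rV[R]_n) (chi : G -> R)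
  (psi phi psiNF Rem : 'rV[R]_m -> 'rV[R]_n -> 'rV[R]_n)
  (S0 N0 : 'M[R]_n)
  (Psi : 'rV[R]_m -> 'rV[R]_n -> (int -> 'rV[R]_n) -> 'rV[R]_n)
  (Sigma : 'rV[R]_m -> 'rV[R]_n -> (int -> 'rV[R]_n) -> (int -> 'rV[R]_n))
  (vstar : 'rV[R]_m -> 'rV[R]_n -> (int -> 'rV[R]_n)) :
  let A lam := 'J (psi lam) (0 : 'rV[R]_n) in
  let U := fixU S0 q in
  let xstar := LS_point S0 vstar in
  let psir := LS_map Psi vstar in
  let DUpsir lam := 'J (in_basis U (psir lam)) (0 : 'rV[R]_(\rank U)) in
  compact [set: G] ->
  continuous_linear_action act ->
  continuous_character chi ->
  local_diffeo_family psi phi ->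
  reversible_equivariant act chi psi phi ->
  (\forall lam \near (0 : 'rV[R]_m), psi lam 0 = 0) ->
  A 0 \in unitmx ->
  Jordan_Chevalley (A 0) S0 N0 ->
  (1 <= k)%N ->
  smooth_family psiNF ->
  smooth_family Rem ->
  (\forall z \near ((0, 0) : 'rV[R]_n * 'rV[R]_m),
     psi z.2 z.1 = psiNF z.2 z.1 + Rem z.2 z.1) ->
  (\forall z \near ((0, 0) : 'rV[R]_n * 'rV[R]_m),
     psiNF z.2 (z.1 *m S0) = psiNF z.2 z.1 *m S0) ->
  uniform_O setT k.+1 Rem ->
  (1 <= q)%N ->
  LS_components S0 q psi Psi Sigma ->
  LS_solution S0 q Sigma vstar ->
  [/\ uniform_O (inU U) k.+1 (fun lam u => xstar lam u - u),
      uniform_O (inU U) k.+1 (fun lam u => psir lam u - psiNF lam u),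
      \forall lam \near (0 : 'rV[R]_m),
        [/\ stablemx U ('J (psiNF lam) (0 : 'rV[R]_n)), stablemx U (A lam),
            differentiable (in_basis U (psir lam)) 0,
            DUpsir lam = restrictmx U ('J (psiNF lam) (0 : 'rV[R]_n)) &
            restrictmx U ('J (psiNF lam) (0 : 'rV[R]_n))
              = restrictmx U (A lam)] &
      exists2 r0 : R, 0 < r0 & forall r : R, 0 < r -> r <= r0 ->
        \forall lam \near (0 : 'rV[R]_m), forall z : R[i],
          (eigenvalue (complexify (DUpsir lam)) z <->
             eigenvalue (complexify (A lam)) z /\ near_unity_root q r z) /\
          (near_unity_root q r z ->
             mup z (char_poly (complexify (DUpsir lam)))
               = mup z (char_poly (complexify (A lam))))].
Proof.
move=> A U xstar psir DUpsir _ _ _ [spsi _ _ _] _ psi0 uA JC k0 sNF sRem psiE NFS RemO q0 comps sol.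
have [AE uS cSN [j Nj] [P [[PD DP] idP PP cP]]] := Jordan_Chevalley_projection q uA JC.
have cPS : GRing.comm P S0 by apply/commr_sym/cP; exact: commr_refl.
have cPN : GRing.comm P N0 by apply/commr_sym/cP; exact: commr_sym.
have [C [d [C0 d0 est]]] := LS_reduction_estimate q0 uS cSN Nj PD DP (idP 1%N) PP cPS cPN
  spsi AE psi0 psiE NFS RemO comps sol.
have [_ dS _ _] := JC.
have capD := complexify_ker_cap q dS.
have [d1 d10 diffpsi] := smooth_family_C1 spsi.
have /near_pair0P[d2 d20 psiE'] := psiE.
have /near_pair0P[d3 d30 NFS'] := NFS.
have /uniform_OP[CR [d4 [CR0 d40 RemO']]] := RemO.
(* psi and psiNF differ by a remainder of order k + 1 >= 2, so A_lam is also the derivative of the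
   normal form. *)
have JNF lam : `|lam| < Num.min (Num.min d1 d2) d4 ->
    is_diff 0 (psiNF lam) (fun x => x *m A lam).
  rewrite !lt_min => /andP[/andP[l1 l2] l4].
  have [dpsi _] : differentiable (psi lam) 0 /\ _ := diffpsi 0 lam ltac:(by rewrite normr0) l1.
  apply: (@jacobian_near_eq _ _ _ _ _ CR (Num.min d2 d4) k) => //.
    by rewrite lt_min d20.
  move=> x; rewrite lt_min => /andP[x2 x4].
  by rewrite psiE' //= addrAC subrr add0r RemO'.
(* The commutation of the normal form with S_0 passes to A_lam through its derivative at 0. *)
have stab lam : `|lam| < Num.min (Num.min (Num.min d1 d2) d4) d3 ->
    A lam *m (S0 ^+ q - 1) = (S0 ^+ q - 1) *m A lam.
  rewrite lt_min => /andP[l1 l3]; have dNF := JNF lam l1.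
  have : S0 *m A lam = A lam *m S0.
    rewrite -(is_diff_jacobian dNF); apply: (jacobian_commute d30); first by have [] := dNF.
    by move=> x x3; exact: NFS'.
  move=> cSA; apply: (@commrB _ (A lam)); last exact: commr1.
  by apply: commrX; exact: esym.
have Ustab lam : A lam *m (S0 ^+ q - 1) = (S0 ^+ q - 1) *m A lam -> stablemx U (A lam).
  by move=> cAD; apply/sub_kermxP; rewrite -mulmxA cAD mulmxA mulmx_ker mul0mx.
have DU lam : `|lam| < Num.min (Num.min (Num.min d1 d2) d4) d ->
    is_diff 0 (in_basis U (psir lam)) (fun w => w *m restrictmx U (A lam)).
  rewrite lt_min => /andP[l1 ld]; have dNF := JNF lam l1.
  rewrite -(is_diff_jacobian dNF).
  apply: (@in_basis_is_diff _ _ _ _ _ C d k) => //.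
  by move=> u uU ud; have [] := est lam u uU ud ld.
have cA : entrywise_continuous A.
  move=> a b; apply/(@cvgrPdist_le _ _ _ (nbhs (0 : 'rV[R]_m))) => e e0.
  have [d5 d50 h] := smooth_family_jacobian_near spsi e0.
  apply/near0P; exists d5 => // lam ld; rewrite distrC.
  by apply: h; rewrite ?normr0.
split.
- apply/uniform_OP; exists C, d; split=> // u lam uU ud ld.
  have [h _] := est lam u uU ud ld.
  by rewrite /xstar /LS_point /xi /= expr0 mulmx1 addrAC subrr add0r.
- apply/uniform_OP; exists C, d; split=> // u lam uU ud ld.
  have [_ h] := est lam u uU ud ld.
  by rewrite distrC.
- apply/near0P; exists (Num.min (Num.min (Num.min (Num.min d1 d2) d4) d3) d).
    by rewrite !lt_min d10 d20 d30 d40.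
  move=> lam; rewrite lt_min => /andP[l1 ld].
  have l2 : `|lam| < Num.min (Num.min d1 d2) d4 by move: l1; rewrite lt_min => /andP[].
  have := JNF lam l2 => /is_diff_jacobian ->.
  have sU := Ustab lam (stab lam l1).
  have dU : is_diff 0 (in_basis U (psir lam)) (fun w => w *m restrictmx U (A lam)).
    by apply: DU; rewrite lt_min l2.
  by split=> //; exact: is_diff_jacobian.
have [r0 r00 off] := off_ker_spectrum q0 cSN Nj PD DP idP PP cPS cPN AE cA.
exists r0 => // r rgt0 rr0.
have near1 : \forall lam \near (0 : 'rV[R]_m),
    A lam *m (S0 ^+ q - 1) = (S0 ^+ q - 1) *m A lam.
  apply/near0P; exists (Num.min (Num.min (Num.min d1 d2) d4) d3); last exact: stab.
  by rewrite !lt_min d10 d20 d30 d40.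
have near2 : \forall lam \near (0 : 'rV[R]_m), DUpsir lam = restrictmx U (A lam).
  apply/near0P; exists (Num.min (Num.min (Num.min d1 d2) d4) d).
    by rewrite !lt_min d10 d20 d40.
  by move=> lam /DU /is_diff_jacobian.
have near3 := ker_spectrum q0 cSN Nj DP idP cPN AE cA rgt0.
have near4 := off r rr0.
apply: filterS (filterI near1 (filterI near2 (filterI near3 near4))).
move=> lam [cAD [-> [on offl]]] z.
have sU := Ustab lam cAD.
have sD : stablemx (S0 ^+ q - 1) (A lam) by rewrite -cAD submxMl.
have chiE : char_poly (complexify (A lam)) =
    char_poly (complexify (restrictmx U (A lam))) *
    char_poly (complexify (restrictmx (S0 ^+ q - 1) (A lam))).
  by rewrite -!map_char_poly -rmorphM; congr map_poly; exact: char_poly_restrict.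
have offz := offl z sD.
rewrite -![eigenvalue _ z]/(eigenvalue _ z) !eigenvalue_root_char chiE rootM; split.
  split=> [rU|[/orP[//|rD] /offz]]; last by rewrite rD.
  by split; [rewrite rU | exact: on z sU rU].
(* Near a root of unity the factor from Im D does not vanish, so the multiplicity comes from U
   alone. *)
by move=> /offz nr; rewrite mupMl.
Qed.
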